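(* (i) For every $c\in\mathbb{N}$ there exists $m(c)\in\mathbb{N}$ satisfying the following: for each $\ell\in\mathbb{N}$ there exists an irreducible, torsion free, finitely generated nilpotent group $\Gamma$ of step length $c$ with $h(\Gamma)\ge\ell$ such that $\mathrm{F}_\Gamma(n)\preceq(\log n)^{m(c)}$. (ii) Every natural number $m\ne 2$ can be realized as the polynomial in logarithm degree of growth of $\mathrm{F}_\Gamma(n)$ (that is, $\mathrm{F}_\Gamma(n)\approx(\log n)^m$) for some irreducible, torsion free, finitely generated nilpotent group $\Gamma$. (iii) Suppose $2\le c_1<c_2$ are natural numbers. For each $\ell\in\mathbb{N}$ there exist irreducible, torsion free, finitely generated nilpotent groups $\Gamma_\ell$ and $\Delta_\ell$ of step lengths $c_1$ and $c_2$, respectively, such that $\mathrm{F}_{\Gamma_\ell}(n)\approx\mathrm{F}_{\Delta_\ell}(n)$. (iv) For natural numbers $c>1$ and $m\ge1$ there exists an irreducible, torsion free, finitely generated nilpotent group $\Gamma$ of step length $c$ such that $(\log n)^m\preceq\mathrm{F}_\Gamma(n)$.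
   Context: $\mathbb{N}=\{1,2,\dots\}$. For non-decreasing non-negative functions $f,g$ on $\mathbb{N}$, write $f\preceq g$ if there is $C\in\mathbb{N}$ with $f(n)\le C\,g(Cn)$ for all $n$, and $f\approx g$ if $f\preceq g$ and $g\preceq f$. For a finitely generated group $\Gamma$ with finite generating subset $S$ and word length $\|\cdot\|_S$, put $\mathrm{D}_\Gamma(\gamma)=\min\{|Q| : \varphi:\Gamma\to Q \text{ a surjective homomorphism to a finite group},\ \varphi(\gamma)\ne 1\}$ for $\gamma\neq1$, and $\mathrm{F}_{\Gamma,S}(n)=\max\{\mathrm{D}_\Gamma(\gamma) : \gamma\ne 1,\ \|\gamma\|_S\le n\}$. Up to $\approx$ this is independent of $S$, and one writes $\mathrm{F}_\Gamma$. A group is irreducible if it has no non-trivial splitting as a direct product. $h$ denotes Hirsch length. The step length of a nilpotent group $\Gamma$ is the minimal $c$ with $\Gamma_{c+1}=\{1\}$, where $\Gamma_1=\Gamma$ and $\Gamma_i=[\Gamma_{i-1},\Gamma]$. For a function of the form $(\log n)^m$, the number $m$ is called its polynomial in logarithm degree of growth.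
   Formalization: In (i), for step length c = 1 only ℓ = 1 is claimed: an irreducible, torsion free, finitely generated abelian group of step length 1 is infinite cyclic, so h(Γ) = 1 and the claim is false for c = 1, ℓ ≥ 2. *)

(* Defs.v *)
From HB Require Import structures.
From mathcomp Require Import all_boot all_order all_algebra all_fingroup.
From mathcomp Require Import all_classical all_reals all_analysis.

Set Implicit Arguments.
Unset Strict Implicit.
Unset Printing Implicit Defensive.

Import Order.TTheory GRing.Theory Num.Theory.
Local Open Scope classical_set_scope.
Local Open Scope group_scope.

(* The value is 0 when the minimum (resp. maximum) does not exist. *)
Definition nat_min (A : set nat) : nat := xget 0%N (A `&` lbound A).
Definition nat_max (A : set nat) : nat := xget 0%N (A `&` ubound A).

Section Subgroups.
Variable G : groupType.
Implicit Types (H K N : set G) (S : seq G).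

Definition is_subgroup H : Prop :=
  [/\ H 1, forall x y, H x -> H y -> H (x * y) & forall x, H x -> H x^-1].

Definition generated (A : set G) : set G := smallest is_subgroup A.

Definition generates S : Prop := generated [set` S] = setT.

Definition finitely_generated : Prop := exists S : seq G, generates S.

Definition torsion_free : Prop :=
  forall (x : G) (n : nat), (0 < n)%N -> x ^+ n = 1 -> x = 1.

Definition is_direct_product H K : Prop :=
  [/\ is_subgroup H, is_subgroup K,
      forall x y, H x -> K y -> commute x y,
      H `&` K = [set 1]
    & forall z, exists x y, [/\ H x, K y & z = x * y]].

Definition irreducible : Prop :=
  forall H K, is_direct_product H K -> H = [set 1] \/ K = [set 1].

(* [lower_central k] is the term of index [k + 1], so [lower_central 0] is the
   whole group. *)
Fixpoint lower_central (k : nat) : set G :=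
  if k is k'.+1 then
    generated [set z | exists x y, lower_central k' x /\ z = [~ x, y]]
  else setT.

Definition nilpotent_group : Prop := exists c, lower_central c = [set 1].

Definition step_length : nat := nat_min [set c | lower_central c = [set 1]].

Definition left_coset (x : G) H : set G := [set x * h | h in H].

Definition normal_in N K : Prop :=
  N `<=` K /\ forall x y, N x -> K y -> N (x ^ y).

Definition cyclic_quotient K N : Prop :=
  exists2 t, K t &
    forall x, K x -> exists k : nat,
      left_coset x N = left_coset (t ^+ k) N \/
      left_coset x N = left_coset (t ^- k) N.

Definition infinite_quotient K N : Prop :=
  infinite_set [set left_coset x N | x in K].

Definition polycyclic_series (n : nat) (H : nat -> set G) : Prop :=
  [/\ H 0%N = [set 1], H n = setT,
      forall i, (i <= n)%N -> is_subgroup (H i),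
      forall i, (i < n)%N -> normal_in (H i) (H i.+1)
    & forall i, (i < n)%N -> cyclic_quotient (H i.+1) (H i)].

Definition infinite_factors (n : nat) (H : nat -> set G) : nat :=
  \sum_(i < n | `[< infinite_quotient (H i.+1) (H i) >]) 1.

(* The number of infinite factors is the same for every polycyclic series of a
   given group; the value is 0 if there is no such series. *)
Definition hirsch_length : nat :=
  xget 0%N [set h | exists (n : nat) (F : nat -> set G),
    polycyclic_series n F /\ infinite_factors n F = h].

Definition is_word S (w : seq G) : Prop :=
  forall x, x \in w -> x \in S \/ x^-1 \in S.

Definition word_length S (g : G) : nat :=
  nat_min [set size w | w in [set w | is_word S w /\ \prod_(x <- w) x = g]].

Definition detection (g : G) : nat :=
  nat_min [set q | exists (Q : finGroupType) (phi : {multiplicative G -> Q}),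
    [/\ forall y, exists x, phi x = y, phi g <> 1 & #|Q| = q]].

Definition rf_growth S (n : nat) : nat :=
  nat_max [set detection g | g in
    [set g | g <> 1 /\ (word_length S g <= n)%N]].

End Subgroups.

Arguments finitely_generated : clear implicits.
Arguments torsion_free : clear implicits.
Arguments irreducible : clear implicits.
Arguments nilpotent_group : clear implicits.
Arguments step_length : clear implicits.
Arguments hirsch_length : clear implicits.

Definition irreducible_tf_fg_nilpotent (G : groupType) : Prop :=
  [/\ irreducible G, torsion_free G, finitely_generated G & nilpotent_group G].

Local Open Scope ring_scope.

Section Growth.
Variable R : realType.
Implicit Types f g : nat -> R.

Definition preceq f g : Prop :=
  exists2 C : nat, (0 < C)%N &
    forall n : nat, (0 < n)%N -> f n <= C%:R * g (C * n)%N.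

Definition growth_equiv f g : Prop := preceq f g /\ preceq g f.

Definition log_pow (m : nat) : nat -> R := fun n => ln n%:R ^+ m.

Definition rf_growthR (G : groupType) (S : seq G) : nat -> R :=
  fun n => (rf_growth S n)%:R.

(* The residual finiteness growth of a group is a class of functions modulo
   [growth_equiv], so relations on it are required for every finite generating
   set. *)
Definition rf_preceq (G : groupType) f : Prop :=
  forall S : seq G, generates S -> preceq (rf_growthR S) f.

Definition preceq_rf f (G : groupType) : Prop :=
  forall S : seq G, generates S -> preceq f (rf_growthR S).

Definition rf_equiv (G : groupType) f : Prop :=
  forall S : seq G, generates S -> growth_equiv (rf_growthR S) f.

Definition rf_equiv_rf (G D : groupType) : Prop :=
  forall (S : seq G) (T : seq D), generates S -> generates T ->
    growth_equiv (rf_growthR S) (rf_growthR T).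

End Growth.

(* Main.v *)
Require Import Defs.
From HB Require Import structures.
From mathcomp Require Import all_boot all_order all_algebra all_fingroup.
From mathcomp Require Import cyclic zify.
From mathcomp Require Import all_classical all_reals all_analysis.

Set Implicit Arguments.
Unset Strict Implicit.
Unset Printing Implicit Defensive.
Import Order.TTheory GRing.Theory Num.Theory.

(** The four clauses are read off one family of groups. Let translations
    of affine space, with coordinates X, Y_1, ..., Y_m, act by substitution on the
    module V spanned by the functions 1, X, ..., X^(l+1) and by Y_1, ..., Y_m; when
    [g] holds, Y_1 is replaced by the glued function X^(l+2) + Y_1. The group
    [shift_group l m g b R] is the semidirect product of the translations (s, t)
    with entries in the ring R and of b copies of V. Every law is polynomial with
    integer coefficients, so reduction modulo any q sends the integer points onto
    the finite group of points over Z/q.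

    Commutation with a translation is a finite difference: it lowers the degree
    by one and multiplies the leading coefficient by a positive integer. For b > 0
    (and m > 0 if [g] holds) the group of integer points is therefore torsion free
    nilpotent, of step length c = l + 2 or l + 3 as [g] fails or holds, and its
    centre is formed by the constants ([central_const]). It is irreducible: two
    normal subgroups not contained in V^b both contain non-zero multiples of the same
    constant, and a direct factor inside V^b is central, hence consists of
    commutators, hence lies in the other factor ([irreducible_criterion]).

    Upper bound ([detection_upper]). The coordinates of a word of length n are
    polynomially bounded in n, so a non-zero coordinate of a non-trivial element
    fails to be divisible by some q at most of order log n: a number divisible by
    every q <= 2 h is divisible by the binomial coefficient of 2 h over h, which is
    at least 2 ^ h ([small_nondivisor]). Projecting to a single copy of V and
    reducing modulo q gives a quotient of order q ^ D with D = 1 + m + (l + 2 + m),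
    for every b > 0.

    Lower bound for b = 1 ([finite_quotient_box], [detection_lower]). If a finite
    quotient maps a suitable constant z to an element of order r, then all r ^ D
    elements with coordinates in [0, r[ have different images: a coincidence gives
    an element of the kernel with a non-zero leading coordinate smaller than r, and
    finite differences turn it into a constant that contradicts the order of z.
    Apply this to z ^ N, where N <= 16 ^ x is a common multiple of 1, ..., x
    ([small_common_multiple]): any quotient detecting z ^ N has r > x, hence order
    more than x ^ D, while the word length of z ^ N is at most exponential in x.

    So the growth is (log n) ^ D for b = 1, and at most that for b > 1. With m = 0
    and [g] false, D = c + 1: taking b large makes the Hirsch length large while
    the step length and the bound stay put, which is clause (i), and b = 1 realizes
    every exponent at least 3 in clause (ii). The gluing exists for the sake of parity:
    D is odd exactly when l is even, and each step length c >= 2 is l + 2 or l + 3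
    for an even l. Hence every step length c >= 2 occurs with every large odd
    exponent ([odd_exponent_of_step]), which gives clauses (iii) and (iv). The
    infinite cyclic group, the case b = m = 0, settles what remains. *)

(** * Common multiples and non-divisors of logarithmic size *)

Lemma dvdn_of_logn r N : (0 < r)%N -> (0 < N)%N ->
  (forall p, prime p -> logn p r <= logn p N)%N -> r %| N.
Proof.
move=> r0 N0 h; apply/dvdn_partP => // p; rewrite mem_primes => /andP[pp _].
by rewrite p_part pfactor_dvdn // h.
Qed.

Lemma exp_logn_le p r : (0 < r)%N -> (p ^ logn p r <= r)%N.
Proof. by move=> r0; rewrite -p_part dvdn_leq // dvdn_part. Qed.

(** Legendre's formula, with the sum running past the last non-zero term so that
    the valuations of two factorials can be compared term by term. *)
Lemma logn_fact_wide p h x : prime p -> (h <= x)%N ->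
  logn p h`! = (\sum_(1 <= k < x.+1) h %/ p ^ k)%N.
Proof.
move=> pp hx; have p1 := prime_gt1 pp.
rewrite logn_fact // [RHS](big_cat_nat _ (n := h.+1)) //= [X in (_ + X)%N]big_nat.
rewrite [X in (_ + X)%N]big1 ?addn0 // => i /andP[hi _].
by rewrite divn_small // (leq_trans hi) // ltnW // ltn_expl.
Qed.

Lemma bin_le_two_exp n k : ('C(n, k) <= 2 ^ n)%N.
Proof.
have [kn|nk] := leqP k n; last by rewrite bin_small.
have := Pascal 1 1 n; rewrite addn1 => ->.
rewrite (bigD1 (inord k)) //= inordK ?ltnS // !exp1n !muln1.
exact: leq_addr.
Qed.

(** When [h < p ^ e <= x], the term of index [e] in Legendre's formula is positive
    for [x`!] and zero for [h`!]; every other term for [x`!] is at least twice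
    the corresponding term for [h`!]. *)
Lemma logn_fact_half p h x e : prime p -> (h.*2 <= x)%N -> (h < p ^ e <= x)%N -> (0 < e)%N ->
  ((logn p h`!).*2 < logn p x`!)%N.
Proof.
move=> pp hx /andP[he ex] e0.
have p1 := prime_gt1 pp.
have hle : (h <= x)%N by rewrite (leq_trans _ hx) // -addnn leq_addl.
rewrite (logn_fact_wide pp hle).
have ein : (1 <= e < x.+1)%N by rewrite e0 ltnS (leq_trans _ ex) // ltnW // ltn_expl.
have Ee (F : nat -> nat) : (\sum_(1 <= k < x.+1) F k =
    F e + \sum_(1 <= k < x.+1 | k != e) F k)%N.
  by rewrite (bigD1_seq e) ?mem_index_iota ?iota_uniq.
rewrite logn_fact // !Ee doubleD divn_small // add0n.
apply: (@leq_ltn_trans (\sum_(1 <= k < x.+1 | k != e) x %/ p ^ k)%N).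
  rewrite -muln2 big_distrl leq_sum //= => k _.
  rewrite leq_divRL ?expn_gt0 ?(ltnW p1) // mulnAC muln2.
  by rewrite (leq_trans _ hx) // leq_double leq_trunc_div.
by rewrite -[X in (X < _)%N]add0n ltn_add2r divn_gt0 ?expn_gt0 ?(ltnW p1).
Qed.

(** This is Chebyshev's bound on the least common multiple of 1, ..., x, obtained
    by halving: passing from h = x./2 to x, the exponent of each prime grows by at
    most one, and only when a power of that prime lies in ]h, x], in which case the
    prime divides [x`! / (h`! * h`!)], a number of exponential size. *)
Lemma small_common_multiple x :
  exists2 N, (0 < N <= 16 ^ x)%N & forall r, (0 < r <= x)%N -> r %| N.
Proof.
elim/ltn_ind: x => -[|x'] IH.
  by exists 1%N => // r; case: r.
set x := x'.+1; pose h := x./2.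
have hlt : (h < x)%N by rewrite /h /x; lia.
have [N /andP[N0 Nle] Ndiv] := IH _ hlt.
have hx : (h <= x)%N by exact: ltnW.
(* The factor h.+1 makes the binomial a multiple of x`! / (h`! * h`!) for odd x. *)
exists (N * ('C(x, h) * h.+1))%N => [|r /andP[r0 rx]].
  rewrite !muln_gt0 N0 bin_gt0 hx /=.
  have b1 := bin_le_two_exp x h.
  have b2 : (h.+1 <= 2 ^ h)%N by rewrite ltn_expl.
  apply: (@leq_trans (16 ^ h * (2 ^ x * 2 ^ h))); first by rewrite !leq_mul.
  rewrite -[16]/(2 ^ 4) -!expnM -!expnD leq_exp2l //.
  have : (h.*2 <= x)%N by rewrite /h; lia.
  lia.
apply: dvdn_of_logn; rewrite ?muln_gt0 ?N0 ?bin_gt0 ?hx // => p pp.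
have p1 := prime_gt1 pp.
set e := logn p r.
have ex : (p ^ e <= x)%N by apply: leq_trans (exp_logn_le _ r0) rx.
have [leh|lth] := leqP (p ^ e) h.
  rewrite lognM ?muln_gt0 ?bin_gt0 ?hx //.
  apply: leq_trans (leq_addr _ _).
  by rewrite -pfactor_dvdn // Ndiv // leh expn_gt0 ltnW.
case: (posnP e) => [->//|e0].
have h2 : (h.*2 <= x)%N by rewrite /h; lia.
have lt := @logn_fact_half p h x e pp h2 _ e0.
move: lt; rewrite lth ex => /(_ isT) lt.
have le1 : (e.-1 <= logn p N)%N.
  rewrite -pfactor_dvdn // Ndiv // expn_gt0 (ltnW p1) /=.
  have : (p * p ^ e.-1 <= x)%N by rewrite -expnS prednK.
  have : (2 * p ^ e.-1 <= p * p ^ e.-1)%N by rewrite leq_mul2r p1 orbT.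
  by rewrite /h; lia.
have le2 : (logn p x`! <= (logn p h`!).*2 + logn p ('C(x, h) * h.+1))%N.
  rewrite -(bin_fact hx) -addnn -!lognM ?muln_gt0 ?fact_gt0 ?bin_gt0 ?hx //.
  rewrite dvdn_leq_log ?muln_gt0 ?fact_gt0 ?bin_gt0 ?hx //.
  have fdiv : (x - h)`! %| h.+1`!.
    have [-> | ->] : (x - h = h \/ x - h = h.+1)%N by rewrite /h; lia.
      by rewrite factS dvdn_mull.
    by [].
  have -> : ('C(x, h) * (h`! * (x - h)`!) = ('C(x, h) * h`!) * (x - h)`!)%N by lia.
  have -> : (h`! * h`! * ('C(x, h) * h.+1) = ('C(x, h) * h`!) * (h.+1 * h`!))%N by lia.
  by rewrite dvdn_mul.
rewrite lognM ?muln_gt0 ?bin_gt0 ?hx //.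
by move: lt le1 le2 e0; lia.
Qed.

Lemma two_exp_le_bin h : (2 ^ h <= 'C(h.*2, h))%N.
Proof.
elim: h => [|h IH] //.
rewrite doubleS binS expnS mul2n -addnn leq_add //; apply: leq_trans IH _.
  by rewrite binS leq_addl.
by rewrite leq_bin2l.
Qed.

(** Each of the terms h.*2 %/ p ^ k - 2 * (h %/ p ^ k) of Legendre's formula is 0 or
    1, and it vanishes as soon as p ^ k exceeds h.*2. *)
Lemma logn_bin_half p h : prime p -> (0 < h)%N -> (logn p 'C(h.*2, h) <= trunc_log p h.*2)%N.
Proof.
move=> pp h0; have p1 := prime_gt1 pp.
have hle : (h <= h.*2)%N by rewrite -addnn leq_addl.
have E : (logn p (h.*2)`! = logn p 'C(h.*2, h) + (logn p h`!).*2)%N.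
  rewrite -(bin_fact hle) -addnn addKn !lognM ?muln_gt0 ?fact_gt0 ?bin_gt0 ?leq_addl //.
  by rewrite (addnn (logn _ _)).
have F := logn_fact_wide pp hle.
set t := trunc_log p h.*2.
have G : (logn p (h.*2)`! <= (logn p h`!).*2 + \sum_(1 <= k < h.*2.+1) (k <= t))%N.
  rewrite logn_fact // F -(mul2n (\sum_(1 <= k < h.*2.+1) h %/ p ^ k)).
  rewrite big_distrr -big_split /= leq_sum // => k _.
  have pk : (0 < p ^ k)%N by rewrite expn_gt0 ltnW.
  have [kt|tk] := leqP k t.
    rewrite -ltnS ltn_divLR // {1}(divn_eq h (p ^ k)); move: (ltn_pmod h pk).
    move: (h %/ _)%N (h %% _)%N => q r rl; rewrite /=; lia.
  by rewrite divn_small // (leq_trans (trunc_log_ltn _ p1)) // leq_exp2l.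
have S n : (\sum_(1 <= k < n.+1) (k <= t) <= t)%N.
  suff -> : (\sum_(1 <= k < n.+1) (k <= t) = minn n t)%N by rewrite geq_minr.
  by elim: n => [|n IH]; [rewrite big_geq ?min0n | rewrite big_nat_recr //= IH; lia].
by move: (S h.*2) G; rewrite E; lia.
Qed.

(** Otherwise k is divisible by all prime powers up to h.*2, hence by the central
    binomial coefficient 'C(h.*2, h), which is at least 2 ^ h. *)
Lemma small_nondivisor k : (0 < k)%N ->
  exists2 q, (1 < q <= (trunc_log 2 k).+1.*2)%N & ~~ (q %| k).
Proof.
move=> k0; set h := (trunc_log 2 k).+1.
have [/hasP[q] | /hasPn all] := boolP (has (fun q => ~~ (q %| k)) (iota 2 (h.*2.-1))).
  by rewrite mem_iota => hq nq; exists q => //; move: hq; rewrite /h; lia.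
suff : (2 ^ h <= k)%N by rewrite leqNgt trunc_log_ltn.
apply: leq_trans (two_exp_le_bin h) (dvdn_leq k0 _).
apply: dvdn_of_logn => // [|p pp]; first by rewrite bin_gt0 -addnn leq_addl.
apply: leq_trans (logn_bin_half pp _) _ => //.
rewrite -pfactor_dvdn //; set e := trunc_log _ _.
have [->|e0] := posnP e; first by rewrite expn0 dvd1n.
have pe : (p ^ e <= h.*2)%N by rewrite trunc_logP ?prime_gt1.
have p2 : (p <= p ^ e)%N by rewrite -[X in (X <= _)%N]expn1 leq_exp2l ?prime_gt1.
have := all (p ^ e)%N; rewrite mem_iota negbK; apply.
by have := prime_gt1 pp; lia.
Qed.

Local Open Scope classical_set_scope.

(** * Word length and detection in a group *)

Section AbstractGroups.
Local Open Scope group_scope.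

Lemma nat_minP (A : set nat) : A !=set0 -> A (nat_min A) /\ forall a, A a -> (nat_min A <= a)%N.
Proof.
case=> a Aa; rewrite /nat_min.
suff [m Am] : exists m, (A `&` lbound A) m.
  by case: xgetP => [x _ [Ax lb]|/(_ m)//]; split=> // b /lb.
have ex : exists n, `[< A n >] by exists a; apply/asboolP.
case: (ex_minnP ex) => m /asboolP Am mn; exists m; split=> // b Ab.
by apply: mn; apply/asboolP.
Qed.

Lemma nat_maxP (A : set nat) B : A !=set0 -> (forall a, A a -> (a <= B)%N) ->
  A (nat_max A) /\ forall a, A a -> (a <= nat_max A)%N.
Proof.
move=> [a Aa] hB; rewrite /nat_max.
suff [m Am] : exists m, (A `&` ubound A) m.
  by case: xgetP => [x _ [Ax ub]|/(_ m)//]; split=> // b /ub.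
have ex : exists n, `[< A n >] by exists a; apply/asboolP.
have ub n : `[< A n >] -> (n <= B)%N by move/asboolP/hB.
case: (ex_maxnP ex ub) => m /asboolP Am mx; exists m; split=> // b Ab.
by apply: mx; apply/asboolP.
Qed.

Lemma nat_max_le (A : set nat) B : (forall a, A a -> (a <= B)%N) -> (nat_max A <= B)%N.
Proof. by move=> hB; rewrite /nat_max; case: xgetP => [x _ [Ax _]|//]; apply: hB. Qed.

Section GroupGeneral.
Variable G : groupType.
Implicit Types (H K : set G) (S : seq G).

Lemma subgroupM H x y : is_subgroup H -> H x -> H y -> H (x * y).
Proof. by case=> _ h _; exact: h. Qed.
Lemma subgroupV H x : is_subgroup H -> H x -> H x^-1.
Proof. by case=> _ _; exact. Qed.
Lemma subgroup1 H : is_subgroup H -> H 1.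
Proof. by case. Qed.
Lemma subgroupX H x n : is_subgroup H -> H x -> H (x ^+ n).
Proof.
move=> sH Hx; elim: n => [|n IH]; first by rewrite expg0; apply: subgroup1.
by rewrite expgS; apply: subgroupM.
Qed.

Lemma generated_subgroup (A : set G) : is_subgroup (Defs.generated A).
Proof.
split.
- by move=> H [sH _]; apply: subgroup1.
- by move=> x y Ax Ay H hH; apply: subgroupM; [case: hH| apply: Ax| apply: Ay].
- by move=> x Ax H hH; apply: subgroupV; [case: hH| apply: Ax].
Qed.

Lemma sub_generated (A : set G) : A `<=` Defs.generated A.
Proof. by move=> x Ax H [_]; apply. Qed.

Lemma generated_sub (A : set G) H : is_subgroup H -> A `<=` H -> Defs.generated A `<=` H.
Proof. by move=> sH sA x; apply. Qed.

Lemma is_word_cat S w w' : is_word S w -> is_word S w' -> is_word S (w ++ w').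
Proof. by move=> h h' x; rewrite mem_cat => /orP[/h|/h']. Qed.

Lemma word_exists S g : generates S -> exists w, is_word S w /\ \prod_(x <- w) x = g.
Proof.
move=> gS; pose H : set G := [set g | exists w, is_word S w /\ \prod_(x <- w) x = g].
suff HT : setT `<=` H by exact: HT.
rewrite -gS; apply: generated_sub; last first.
  move=> x /= xS; exists [:: x]; split; last by rewrite big_seq1.
  by move=> y; rewrite inE => /eqP->; left.
split.
- by exists [::]; rewrite big_nil.
- move=> x y [w [hw <-]] [w' [hw' <-]]; exists (w ++ w').
  by rewrite big_cat; split=> //; apply: is_word_cat.
- move=> x [w [hw <-]]; exists (rev (map (fun y => y^-1) w)); split.
    move=> y; rewrite mem_rev => /mapP[z /hw hz ->]; rewrite invgK.
    by case: hz; [right|left].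
  rewrite {hw}; elim: w => [|a w IH]; first by rewrite !big_nil invg1.
  by rewrite /= rev_cons -cats1 big_cat big_seq1 big_cons /= IH invMg.
Qed.

Lemma word_length_le S w : is_word S w -> (word_length S (\prod_(x <- w) x) <= size w)%N.
Proof.
move=> hw; rewrite /word_length; set A := (X in nat_min X).
have [_ h] := @nat_minP A (ex_intro _ (size w) (ex_intro2 _ _ w (conj hw erefl) erefl)).
by apply: h; exists w.
Qed.

Lemma word_length_word S g : generates S ->
  exists w, [/\ is_word S w, \prod_(x <- w) x = g & size w = word_length S g].
Proof.
move=> /(word_exists g)[w [hw e]]; rewrite /word_length; set A := (X in nat_min X).
have [[w' [hw' e'] sw] _] := @nat_minP A (ex_intro _ (size w) (ex_intro2 _ _ w (conj hw e) erefl)).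
by exists w'.
Qed.

Lemma word_length_exp S g k : generates S ->
  (word_length S (g ^+ k) <= k * word_length S g)%N.
Proof.
move=> /(word_length_word g)[w [hw e <-]].
suff [w' [hw' <- <-]] : exists w', [/\ is_word S w', \prod_(x <- w') x = g ^+ k
    & size w' = (k * size w)%N] by exact: word_length_le.
elim: k => [|k [w' [hw' e' sw']]]; first by exists [::]; rewrite big_nil.
exists (w ++ w'); rewrite big_cat size_cat /= e e' sw' -expgS mulSn.
by split=> //; apply: is_word_cat.
Qed.

Definition detects (g : G) (q : nat) : Prop :=
  exists (Q : finGroupType) (phi : {multiplicative G -> Q}),
    [/\ forall y, exists x, phi x = y, phi g <> 1 & #|Q| = q].

Lemma rf_growth_le S n B :
  (forall g, g <> 1 -> (word_length S g <= n)%N -> exists2 q, (q <= B)%N & detects g q) ->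
  (rf_growth S n <= B)%N.
Proof.
move=> h; apply: nat_max_le => _ [g [g1 gn] <-].
have [q qB dq] := h g g1 gn.
have [_ mn] := @nat_minP _ (ex_intro _ q dq).
exact: leq_trans (mn _ dq) qB.
Qed.

(** The bound [B], uniform over the ball, is what makes the maximum defining
    [rf_growth] exist. *)
Lemma rf_growth_ge S n B g k :
  (forall g, g <> 1 -> (word_length S g <= n)%N -> exists2 q, (q <= B)%N & detects g q) ->
  g <> 1 -> (word_length S g <= n)%N -> (forall q, detects g q -> (k <= q)%N) ->
  (k <= rf_growth S n)%N.
Proof.
move=> h g1 gn hk.
have [q qB dq] := h g g1 gn.
have [dm _] := @nat_minP _ (ex_intro _ q dq).
apply: leq_trans (hk _ dm) _.
have := @nat_maxP [set detection g | g in [set g | g <> 1 /\ (word_length S g <= n)%N]] B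
  (ex_intro _ (detection g) (ex_intro2 _ _ g (conj g1 gn) erefl)).
case=> [_ [g' [g'1 g'n] <-]|_ mx]; last by apply: mx; exists g.
have [q' qB' dq'] := h g' g'1 g'n.
have [_ mn] := @nat_minP _ (ex_intro _ q' dq').
exact: leq_trans (mn _ dq') qB'.
Qed.
End GroupGeneral.

(** * Irreducibility and generation *)

Section Normal.
Variable G : groupType.
Implicit Types (H K M N : set G).

Definition normal_subgroup N : Prop := is_subgroup N /\ forall x y, N x -> N (x ^ y).

Lemma normal_commr N x y : normal_subgroup N -> N x -> N [~ x, y].
Proof. by case=> sN nN Nx; apply: subgroupM (nN _ _ Nx); last apply: subgroupV. Qed.

Lemma normal_comml N x y : normal_subgroup N -> N x -> N [~ y, x].
Proof.
move=> nN Nx; rewrite -invgR; apply: subgroupV; first by case: nN.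
exact: normal_commr.
Qed.

Lemma direct_factor_normal H K : is_direct_product H K -> normal_subgroup H /\ normal_subgroup K.
Proof.
case=> sH sK cHK _ dec; split; split=> // x y; have [h [k [Hh Kk ->]]] := dec y => Nx.
  rewrite conjgM [X in H X](_ : _ = x ^ h); last first.
    apply/conjg_fixP/commgP/cHK => //.
    by rewrite conjgE; apply: subgroupM; [|apply: subgroupV|apply: subgroupM].
  by rewrite conjgE; apply: subgroupM; [|apply: subgroupV|apply: subgroupM].
have e : x ^ h = x by apply/conjg_fixP/commgP; apply/esym/cHK.
by rewrite conjgM e conjgE; apply: subgroupM; [|apply: subgroupV|apply: subgroupM].
Qed.

(** By the first hypothesis one factor of a direct product lies in [M]. Being
    abelian, that factor is central, so each of its elements z is a commutator
    [~ x, y]; the central components of x and y in it can be dropped, and z also lies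
    in the other factor. *)
Lemma irreducible_criterion M :
  (forall N N', normal_subgroup N -> normal_subgroup N' ->
     ~ N `<=` M -> ~ N' `<=` M -> exists z, [/\ z <> 1, N z & N' z]) ->
  (forall x y, M x -> M y -> commute x y) ->
  (forall z, M z -> (forall y, commute z y) -> exists x y, z = [~ x, y]) ->
  irreducible G.
Proof.
move=> meet abM central.
have key H K : is_direct_product H K -> K `<=` M -> K = [set 1].
  case=> sH sK cHK HK1 dec KM.
  apply/seteqP; split=> [z Kz|_ ->]; last exact: subgroup1.
  have cK k : K k -> forall y, commute k y.
    move=> Kk y; have [h [k' [Hh Kk' ->]]] := dec y.
    apply: commuteM; first by apply/esym/cHK.
    by apply: abM; apply: KM.
  have [x [y e]] := central z (KM _ Kz) (cK _ Kz).
  have [h [k [Hh Kk ex]]] := dec x; have [h' [k' [Hh' Kk' ey]]] := dec y.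
  suff Hz : H z by rewrite -HK1; split.
  suff -> : z = [~ h, h'].
    by rewrite /commg conjgE; do! (apply: subgroupM || apply: subgroupV).
  rewrite e ex ey.
  have kc u v w : K u -> [~ v * u, w] = [~ v, w].
    move=> Ku; rewrite !commgEl conjMg invMg.
    have /commgP/conjg_fixP -> : commute u w by apply: cK.
    have /commgP/conjg_fixP <- : commute (v^-1 * v ^ w) u by apply/commute_sym/cK.
    by rewrite !conjgE !mulgA.
  by rewrite kc // -invgR kc // invgR.
move=> H K dHK; have [nH nK] := direct_factor_normal dHK.
have [HM|nHM] := pselect (H `<=` M).
  left; apply: (key K H) => //; case: dHK => sH sK cHK HK1 dec; split=> //.
  - by move=> x y Kx Hy; apply/esym/cHK.
  - by rewrite setIC.
  - move=> z; have [h [k [Hh Kk ->]]] := dec z; exists k, h; split=> //; exact: cHK.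
have [KM|nKM] := pselect (K `<=` M); first by right; apply: key dHK KM.
have [z [z1 Hz Kz]] := meet _ _ nH nK nHM nKM.
by case: dHK => _ _ _ HK1 _; have : (H `&` K) z by []; rewrite HK1 => /z1.
Qed.

Lemma subgroup_int_hom H (f : int -> G) : is_subgroup H ->
  (forall a b : int, f (a + b)%R = f a * f b) -> H (f 1%R) -> forall a, H (f a).
Proof.
move=> sH fD H1.
have f0 : f 0%R = 1 by apply: (mulgI (f 0%R)); rewrite -fD addr0 mulg1.
have Hn (k : nat) : H (f (Posz k)).
  elim: k => [|k IH]; first by rewrite f0; apply: subgroup1.
  by rewrite -addn1 PoszD fD; apply: subgroupM.
move=> a; case: (intP a) => [|k|k]; rewrite ?f0; first exact: subgroup1; first exact: Hn.
have -> : f (- Posz k.+1)%R = (f (Posz k.+1))^-1.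
  by apply: (mulgI (f (Posz k.+1))); rewrite -fD subrr f0 mulgV.
by apply: subgroupV.
Qed.

Lemma subgroup_mx_hom H p q (f : 'M[int]_(p, q) -> G) : is_subgroup H ->
  (forall a b, f (a + b)%R = f a * f b) -> (forall i j, H (f (delta_mx i j))) ->
  forall a, H (f a).
Proof.
move=> sH fD Hd a; rewrite (matrix_sum_delta a).
have f0 : f 0%R = 1 by apply: (mulgI (f 0%R)); rewrite -fD addr0 mulg1.
have Hsum I (r : seq I) (F : I -> 'M[int]_(p,q)) :
    (forall i, H (f (F i))) -> H (f (\sum_(i <- r) F i)%R).
  move=> h; elim: r => [|i r IH]; first by rewrite big_nil f0; apply: subgroup1.
  by rewrite big_cons fD; apply: subgroupM.
apply: (Hsum) => i; apply: (Hsum) => j.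
apply: (subgroup_int_hom (f := fun x => f (x *: delta_mx i j)%R)) => // [x y|].
  by rewrite scalerDl fD.
by rewrite scale1r.
Qed.

End Normal.

(** * Hirsch length *)

Section CyclicQuotient.
Variables (G : groupType) (H K : set G).
Hypotheses (sH : is_subgroup H) (sK : is_subgroup K) (nHK : Defs.normal_in H K).

Definition cong (x y : G) := H (x^-1 * y).

Lemma left_coset_eq_cong x y : left_coset x H = left_coset y H -> cong x y.
Proof.
move=> e; have : left_coset x H y by rewrite e; exists 1; rewrite ?mulg1 //; apply: (subgroup1 sH).
by case=> h Hh <-; rewrite /cong mulKg.
Qed.

Lemma congV x y : cong x y -> cong y x.
Proof.
move=> h; rewrite /cong (_ : _ * _ = (x^-1 * y)^-1); first exact: (subgroupV sH).
by rewrite invMg invgK.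
Qed.

Lemma cong_trans x y z : cong x y -> cong y z -> cong x z.
Proof.
move=> h h'; rewrite /cong (_ : x^-1 * z = (x^-1 * y) * (y^-1 * z)); last first.
  by rewrite mulgA mulgK.
exact: (subgroupM sH).
Qed.

Lemma congM x y x' y' : K x' -> cong x y -> cong x' y' -> cong (x * x') (y * y').
Proof.
move=> Kx' h h'; rewrite /cong (_ : _ * _ = (x^-1 * y) ^ x' * (x'^-1 * y')).
  by apply: (subgroupM sH) => //; case: nHK => _; apply.
by rewrite conjgE invMg !mulgA mulgK.
Qed.

Lemma congX x y k : K x -> cong x y -> cong (x ^+ k) (y ^+ k).
Proof.
move=> Kx h; elim: k => [|k IH]; first by rewrite !expg0 /cong mulg1 invg1; apply: (subgroup1 sH).
by rewrite !expgS; apply: congM => //; apply: (subgroupX _ sK).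
Qed.

Lemma cong_inv x y : K x -> K y -> cong x y -> cong x^-1 y^-1.
Proof.
move=> Kx Ky /congV h; rewrite /cong invgK.
rewrite (_ : x * y^-1 = (y^-1 * x) ^ (y^-1)); last by rewrite conjgE invgK mulgA mulKVg.
by case: nHK => _; apply => //; apply: (subgroupV sK).
Qed.

(** Modulo [H], both elements are powers of the same generator. *)
Lemma cyclic_quotient_dependent u x : cyclic_quotient K H -> K u -> K x ->
  ~ H u -> exists (q p : nat) (e : bool), (0 < q)%N /\
    H (x ^+ q * (if e then u ^+ p else u ^- p)).
Proof.
move=> [t Kt tP] Ku Kx Hu.
have tX k (s : bool) : K (if s then t ^+ k else t ^- k).
  by case: s; [|apply: (subgroupV sK)]; apply: (subgroupX _ sK).
have pow y : K y -> exists k (s : bool), cong y (if s then t ^+ k else t ^- k).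
  by move=> /tP[k [|] /left_coset_eq_cong h]; exists k; [exists true|exists false].
have [q [s hu]] := pow u Ku; have [p [s' hx]] := pow x Kx.
have q0 : (0 < q)%N.
  rewrite lt0n; apply/eqP => q0; apply: Hu; move: hu; rewrite q0 expg0 invg1 if_same.
  by rewrite /cong mulg1 => /(subgroupV sH); rewrite invgK.
exists q, p, (s != s'); split=> //.
have hx' := congX q Kx hx; have hu' := congX p Ku hu.
have e (r : bool) k k' :
    (if r then t ^+ k else t ^- k) ^+ k' = if r then t ^+ (k * k') else t ^- (k * k').
  by case: r; rewrite ?expVgn expgnA.
rewrite e in hx'; rewrite e mulnC in hu'.
have inv y : H ((x ^- q)^-1 * y) -> H (x ^+ q * y) by rewrite invgK.
case: (eqVneq s s') => [ess'|ness'] /=; apply: inv.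
  rewrite -/(cong _ _); apply: cong_inv; [exact: (subgroupX _ sK)|exact: (subgroupX _ sK)|].
  by rewrite ess' in hu'; apply: cong_trans hx' (congV hu').
rewrite -/(cong _ _); apply: (@cong_trans _ (if s then t ^+ (p * q) else t ^- (p * q))).
  have := cong_inv (subgroupX q sK Kx) (tX _ _) hx'.
  by case: (s) ness' => //; case: (s') => //=; rewrite invgK.
exact: congV.
Qed.

(** Two of the cosets of the powers of x coincide. *)
Lemma finite_quotient_power x : ~ infinite_quotient K H -> K x ->
  exists2 k, (0 < k)%N & H (x ^+ k).
Proof.
move=> /contrapT fin Kx.
have : ~ {in (fun k => left_coset (x ^+ k) H) @^-1` [set left_coset x H | x in K] &,
    injective (fun k : nat => left_coset (x ^+ k) H)}.
  move=> inj; apply: infinite_nat; apply: sub_finite_set (finite_preimage inj fin).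
  by move=> k _; exists (x ^+ k) => //; apply: (subgroupX _ sK).
apply: contra_notP => noH k1 k2 _ _ /left_coset_eq_cong h.
have key k k' : (k < k')%N -> ~ H (x ^- k * x ^+ k').
  move=> ltk hk; apply: noH; exists (k' - k)%N; first by rewrite subn_gt0.
  by move: hk; rewrite -{1}(subnKC (ltnW ltk)) expgnDr mulKg.
case: (ltngtP k1 k2) => // [/key[]//|lt].
by case: (key _ _ lt); apply: congV.
Qed.

End CyclicQuotient.

(** Intersect the series with the free abelian image of [f] and take rational spans:
    the dimension of the span does not change across a finite factor and grows by
    at most one across an infinite cyclic one. *)
Lemma infinite_factors_ge (G : groupType) N (f : 'rV[int]_N -> G) n (F : nat -> set G) :
  (forall a b, f (a + b)%R = f a * f b) -> (forall a, f a = 1 -> a = 0%R) ->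
  polycyclic_series n F -> (N <= infinite_factors n F)%N.
Proof.
move=> fD f1 [F0 Fn sF nF cF].
have f0 : f 0%R = 1 by apply: (mulgI (f 0%R)); rewrite -fD addr0 mulg1.
have fX a k : f a ^+ k = f (a *+ k)%R.
  by elim: k => [|k IH]; rewrite ?expg0 ?f0 // expgS mulrS fD IH.
have fV a : (f a)^-1 = f (- a)%R by apply: (mulgI (f a)); rewrite mulgV -fD subrr.
pose toQ := fun v : 'rV[int]_N => map_mx (intr : int -> rat) v.
have toQ_B v w : toQ (v + w)%R = (toQ v + toQ w)%R by rewrite /toQ map_mxD.
have toQX v k : toQ (v *+ k)%R = ((k%:R : rat) *: toQ v)%R.
  by rewrite /toQ raddfMn scaler_nat.
suff key i : (i <= n)%N -> exists W : 'M[rat]_N,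
    (\rank W <= \sum_(j < i | `[< infinite_quotient (F j.+1) (F j) >]) 1)%N /\
    forall v, F i (f v) -> (toQ v <= W)%MS.
  have [W [rW hW]] := key n (leqnn n); rewrite /infinite_factors.
  apply: leq_trans rW; rewrite -{1}(mxrank1 rat N); apply: mxrankS.
  apply/row_subP => i; rewrite row1 (_ : delta_mx _ _ = toQ (delta_mx 0%R i)).
    by apply: hW; rewrite Fn.
  by rewrite /toQ map_delta_mx.
elim: i => [|i IH] lein.
  exists 0%R; split; first by rewrite mxrank0.
  by move=> v; rewrite F0 => /f1 ->; rewrite /toQ map_mx0 sub0mx.
have [W [rW hW]] := IH (ltnW lein).
have sH := sF i (ltnW lein); have sK := sF i.+1 lein; have nHK := nF i lein.
rewrite big_mkcond big_ord_recr -big_mkcond /=.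
case: asboolP => [_|fin]; last first.
  exists W; split=> [|v Kv]; first by rewrite addn0.
  have [k k0 Hk] := finite_quotient_power sH sK fin Kv.
  move: Hk; rewrite fX => /hW; rewrite toQX => h.
  have k0' : (k%:R != 0 :> rat)%R by rewrite pnatr_eq0 -lt0n.
  by rewrite -[toQ v]scale1r -(mulVf k0') -scalerA scalemx_sub.
have [all|/existsNP[w /not_implyP[Kw nw]]] :=
    pselect (forall v, F i.+1 (f v) -> (toQ v <= W)%MS).
  by exists W; split=> //; apply: leq_trans rW (leq_addr _ _).
exists (W + toQ w)%MS; split.
  apply: leq_trans (mxrank_adds_leqif _ _) _; apply: leq_add => //.
  exact: rank_leq_row.
move=> v Kv; have nHw : ~ F i (f w) by move/hW.
have [q [p [e [q0 h]]]] := cyclic_quotient_dependent sH sK nHK (cF i lein) Kw Kv nHw.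
have [p' h'] : exists p' : rat, (((q%:R : rat) *: toQ v + p' *: toQ w)%R <= W)%MS.
  exists (if e then p%:R else - p%:R)%R; move: h; rewrite !fX.
  have toQN u : toQ (- u)%R = (- toQ u)%R by rewrite /toQ map_mxN.
  by case: e; rewrite ?fV -fD => /hW; rewrite toQ_B ?toQN !toQX // -scaleNr.
have q0' : (q%:R != 0 :> rat)%R by rewrite pnatr_eq0 -lt0n.
have -> : toQ v = (q%:R^-1 *: ((q%:R *: toQ v + p' *: toQ w) - p' *: toQ w))%R.
  by rewrite addrK scalerA mulVf // scale1r.
apply: scalemx_sub; apply: addmx_sub; first exact: submx_trans h' (addsmxSl _ _).
by rewrite -scaleNr; apply: scalemx_sub; apply: addsmxSr.
Qed.

(** A group with integer coordinates in which, on the elements whose coordinates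
    after the i-th vanish, the i-th one is a homomorphism: killing the coordinates
    one by one from the last gives a polycyclic series. *)
Section Coordinates.
Variables (G : groupType) (N : nat) (coord : G -> 'rV[int]_N).

Definition coord_series (i : nat) : set G :=
  [set x | forall j : 'I_N, (i <= j)%N -> coord x ord0 j = 0%R].

Hypothesis coordM : forall (i : 'I_N) x y,
  coord_series i.+1 x -> coord_series i.+1 y ->
  coord (x * y) ord0 i = (coord x ord0 i + coord y ord0 i)%R.
Hypothesis coord_eq0 : forall x, coord x = 0%R -> x = 1.
Hypothesis coord_onto : forall i : 'I_N, exists t, coord t = delta_mx ord0 i.

Lemma coord_seriesS (i : 'I_N) x :
  coord_series i x <-> coord_series i.+1 x /\ coord x ord0 i = 0%R.
Proof.
split=> [h|[h h0] j]; first by split=> [j /ltnW|]; apply: h.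
by rewrite leq_eqVlt => /orP[/eqP/val_inj <-//|]; apply: h.
Qed.

Lemma coordV (i : 'I_N) x : is_subgroup (coord_series i.+1) -> coord_series i.+1 x ->
  coord x^-1 ord0 i = (- coord x ord0 i)%R.
Proof.
move=> sH hx; have H1 := subgroup1 sH.
have c1 : coord 1 ord0 i = 0%R.
  by apply: (@addrI _ (coord 1 ord0 i)); rewrite -coordM // mulg1 addr0.
apply: (@addrI _ (coord x ord0 i)); rewrite -coordM //; last exact: (subgroupV sH).
by rewrite mulgV c1 subrr.
Qed.

Lemma coord_series_top : coord_series N = setT.
Proof. by apply/seteqP; split=> // x _ j; rewrite leqNgt ltn_ord. Qed.

Lemma coord_series_subgroup i : (i <= N)%N -> is_subgroup (coord_series i).
Proof.
move ed: (N - i)%N => d; elim: d i ed => [|d IH] i ed lei.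
  have -> : i = N by apply/eqP; rewrite eqn_leq lei /= -subn_eq0 ed.
  by rewrite coord_series_top.
have lt : (i < N)%N by rewrite -subn_gt0 ed.
pose i' := Ordinal lt.
have sH : is_subgroup (coord_series i'.+1) by apply: IH => //=; rewrite subnS ed.
rewrite -[i]/(nat_of_ord i'); split.
- apply/coord_seriesS; split; first exact: (subgroup1 sH).
  apply: (@addrI _ (coord 1 ord0 i')).
  by rewrite -coordM ?mulg1 ?addr0 //; apply: (subgroup1 sH).
- move=> x y /coord_seriesS[hx x0] /coord_seriesS[hy y0]; apply/coord_seriesS.
  by split; [exact: (subgroupM sH) | rewrite coordM // x0 y0 addr0].
- move=> x /coord_seriesS[hx x0]; apply/coord_seriesS.
  by split; [exact: (subgroupV sH) | rewrite coordV // x0 oppr0].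
Qed.

Lemma cong_left_coset (H : set G) x y : is_subgroup H -> cong H x y ->
  left_coset x H = left_coset y H.
Proof.
move=> sH h; apply/seteqP; split=> z [k Hk <-].
  exists (y^-1 * x * k); last by rewrite !mulgA mulgV mul1g.
  by apply: (subgroupM sH) => //; apply: (congV sH).
by exists (x^-1 * y * k); [exact: (subgroupM sH) | rewrite !mulgA mulgV mul1g].
Qed.

Lemma coord_polycyclic : polycyclic_series N coord_series.
Proof.
split.
- apply/seteqP; split=> [x h|_ ->].
    by apply: coord_eq0; apply/rowP => j; rewrite mxE; apply: h.
  exact: (subgroup1 (coord_series_subgroup (leq0n _))).
- exact: coord_series_top.
- exact: coord_series_subgroup.
- move=> i lt; pose i' := Ordinal lt; have sH := coord_series_subgroup lt.
  rewrite -[i]/(nat_of_ord i'); split=> [x /coord_seriesS[]//|x y /coord_seriesS[hx x0] hy].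
  have hV := subgroupV sH hy; have hxy := subgroupM sH hx hy.
  apply/coord_seriesS; rewrite conjgE; split; first exact: (subgroupM sH).
  by rewrite !coordM // coordV // x0 add0r addNr.
- move=> i lt; pose i' := Ordinal lt; have sH := coord_series_subgroup lt.
  have sL := coord_series_subgroup (ltnW lt).
  have [t et] := coord_onto i'.
  have ht : coord_series i.+1 t.
    move=> j ij; rewrite et mxE eqxx /=; case: eqP => // ej.
    by rewrite ej ltnn in ij.
  have hX k : coord_series i.+1 (t ^+ k) by apply: (subgroupX _ sH).
  have cX k : coord (t ^+ k) ord0 i' = k%:R%R.
    elim: k => [|k IH]; last by rewrite expgS coordM // IH et mxE !eqxx -natrD.
    rewrite expg0; apply: (@addrI _ (coord 1 ord0 i')).
    by rewrite -coordM ?mulg1 ?addr0 //; apply: (subgroup1 sH).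
  exists t => // x hx; have hV := subgroupV sH hx.
  case e: (coord x ord0 i') => [k|k]; [exists k; left|exists k.+1; right].
    apply: (cong_left_coset sL); apply/(@coord_seriesS i'); split; first exact: (subgroupM sH).
    by rewrite coordM // coordV // e cX natz addNr.
  have hV' := subgroupV sH (hX k.+1).
  apply: (cong_left_coset sL); apply/(@coord_seriesS i'); split; first exact: (subgroupM sH).
  by rewrite coordM // !coordV // e cX natz NegzE subrr.
Qed.

End Coordinates.

(** The existence of a polycyclic series excludes the default value 0 of
    [hirsch_length]; the bound then holds for any series that is chosen. *)
Lemma hirsch_length_ge (G : groupType) N (f : 'rV[int]_N -> G) :
  (exists n (F : nat -> set G), polycyclic_series n F) ->
  (forall a b, f (a + b)%R = f a * f b) -> (forall a, f a = 1 -> a = 0%R) ->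
  (N <= hirsch_length G)%N.
Proof.
move=> [n [F hF]] fD f1; rewrite /hirsch_length.
case: xgetP => [h _ [n' [F' [hF' <-]]]|none]; first exact: infinite_factors_ge fD f1 hF'.
by case: (none (infinite_factors n F)); exists n, F.
Qed.

End AbstractGroups.

Local Open Scope ring_scope.

(** * Translations acting on polynomial functions *)

Lemma coef_XaddC_exp (R : comNzRingType) (s : R) k j :
  (('X + s%:P) ^+ k)`_j = s ^+ (k - j) *+ 'C(k, j).
Proof.
rewrite addrC exprDn coef_sum.
have E (i : 'I_k.+1) : (s%:P ^+ (k - i) * 'X^i *+ 'C(k, i))`_j =
    if i == j :> nat then s ^+ (k - j) *+ 'C(k, j) else 0.
  rewrite coefMn -rmorphXn coefCM coefXn [j == i]eq_sym.
  by case: eqP => [->|_]; rewrite ?mulr1 ?mulr0 ?mul0rn.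
rewrite (eq_bigr _ (fun i _ => E i)).
have [lejk|ltkj] := leqP j k; last first.
  rewrite bin_small // mulr0n big1 // => i _.
  by case: eqP => // eij; have := ltn_ord i; rewrite eij ltnS leqNgt ltkj.
rewrite (bigD1 (inord j)) //= inordK ?ltnS // eqxx big1 ?addr0 // => i nij.
by case: eqP => // eij; case/eqP: nij; apply/val_inj; rewrite /= inordK ?ltnS.
Qed.

(** The parameter [g] selects the group law, defined below, on this set; it appears
    here so that the law is determined by the type. *)
Definition shift_group (l m : nat) (g : bool) (b : nat) (R : Type) : Type :=
  (R * 'cV[R]_m * 'M[R]_(b, l.+2 + m))%type.
HB.instance Definition _ l m g b (R : choiceType) := Choice.on (shift_group l m g b R).
HB.instance Definition _ l m g b (R : finType) := Finite.on (shift_group l m g b R).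

Section Rep.
Variables (l m : nat) (g : bool).
Local Notation n := (l.+2 + m)%N.
Local Notation c := (l.+2 + g)%N.

(** Row i < c holds the coefficients of (X + s) ^ i, also when i = l + 2 stands for the
    glued function X ^ (l + 2) + Y_1; the remaining functions Y_k do not involve X. *)
Definition shift_mx (R : comNzRingType) (s : R) : 'M[R]_n :=
  \matrix_(i, j) (s ^+ (i - j) *+ ('C(i, j) * ((i < c)%N || (i == j)))).

Definition const_row (R : comNzRingType) : 'rV[R]_n := \row_j (j == 0 :> nat)%:R.

(** The translation by [t] adds the constant [t k] to the k-th extra function. *)
Definition rep (R : comNzRingType) (s : R) (t : 'cV[R]_m) : 'M[R]_n :=
  shift_mx s + col_mx 0 t *m const_row R.

Section Ring.
Variable R : comNzRingType.
Implicit Types (s : R) (t : 'cV[R]_m).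

(** Entrywise this is the expansion of (X + s + s') ^ i in powers of X + s'. *)
Lemma shift_mxD s s' : shift_mx (s + s') = shift_mx s *m shift_mx s'.
Proof.
apply/matrixP => i j; rewrite !mxE.
have [ltic|leci] := ltnP i c; last first.
  rewrite (bigD1 i) //= !mxE eqxx subnn orbT binn !expr0 mul1r big1 ?addr0.
    by rewrite (ltnNge i) leci /=; case: eqP => [->|_]; rewrite ?muln0 // subnn.
  by move=> k nki; rewrite !mxE ltnNge leci /= eq_sym (negPf nki) muln0 mul0r.
rewrite muln1 /=.
have -> : (s + s') ^+ (i - j) *+ 'C(i, j) = (('X + (s + s')%:P) ^+ i)`_j.
  by rewrite coef_XaddC_exp.
rewrite polyCD addrCA exprDn coef_sum.
transitivity (\sum_(k < n | (k < i.+1)%N)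
    s ^+ (i - k) *+ 'C(i, k) * (s' ^+ (k - j) *+ 'C(k, j))).
  rewrite (big_ord_widen n (fun k => (s%:P ^+ (i - k) * ('X + s'%:P) ^+ k *+ 'C(i, k))`_j)) //.
  apply: eq_bigr => k _.
  by rewrite coefMn -rmorphXn coefCM coef_XaddC_exp mulrnAl.
rewrite big_mkcond /=; apply: eq_bigr => k _; rewrite !mxE ltic /= muln1.
rewrite ltnS.
have [leki|ltik] := leqP k i; last by rewrite bin_small // mulr0n mul0r.
by rewrite (leq_ltn_trans leki ltic) muln1.
Qed.

Lemma shift_mx0 : shift_mx (0 : R) = 1%:M.
Proof.
apply/matrixP => i j; rewrite !mxE; case: (ltngtP i j) => [ltij|gtij|/val_inj->].
- by rewrite bin_small // -val_eqE (ltn_eqF ltij).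
- by rewrite expr0n subn_eq0 leqNgt gtij mul0rn -val_eqE gtn_eqF.
- by rewrite subnn expr0 binn eqxx orbT.
Qed.

Lemma const_row_shift s : const_row R *m shift_mx s = const_row R.
Proof.
apply/rowP => j; rewrite !mxE (bigD1 (lshift m ord0)) //= big1 ?addr0.
  rewrite !mxE eqxx mul1r sub0n expr0 /= bin0n.
  by case: (nat_of_ord j).
by move=> k nk; rewrite !mxE -(inj_eq val_inj) /= in nk *; rewrite (negPf nk) mul0r.
Qed.

Lemma const_row_col t : const_row R *m col_mx 0 t = 0.
Proof.
apply/matrixP => i j; rewrite !mxE big1 // => k _; rewrite !mxE.
by case: splitP => [k' ->|k' ->]; rewrite ?mxE ?mulr0 // mul0r.
Qed.

(** A translation along X produces extra functions only out of themselves: the terms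
    of (X + s) ^ (l + 2) of lower degree lie in the span of 1, ..., X ^ (l + 1). *)
Lemma shift_mx_col s t : shift_mx s *m col_mx 0 t = col_mx 0 t.
Proof.
apply/matrixP => i j; rewrite mxE (bigD1 i) //= big1 => [|k nki].
  by rewrite mxE subnn expr0 binn eqxx orbT mul1r addr0.
rewrite [col_mx 0 t k j]mxE; case: splitP => [k' _|k' ek]; first by rewrite !mxE mulr0.
rewrite mxE; case: (ltngtP i k) => [ltik|ltki|eik].
- by rewrite bin_small // mulr0n mul0r.
- suff /negPf-> : ~~ (i < c)%N by rewrite eq_sym (negPf nki) muln0 mulr0n mul0r.
  rewrite -leqNgt; apply: leq_trans ltki; rewrite ek -addnS leq_add2l.
  by case: (g).
- by case/eqP: nki; apply/val_inj.
Qed.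

Lemma repD s s' t t' : rep (s + s') (t + t') = rep s t *m rep s' t'.
Proof.
rewrite /rep mulmxDl !mulmxDr !mulmxA shift_mx_col -shift_mxD -addrA; congr (_ + _).
rewrite -[in RHS]mulmxA const_row_shift -!mulmxA [const_row R *m (_ *m _)]mulmxA.
rewrite const_row_col mul0mx mulmx0 addr0 -mulmxDl; congr (_ *m _).
by rewrite add_col_mx addr0 addrC.
Qed.

Lemma rep0 : rep (0 : R) 0 = 1%:M.
Proof. by rewrite /rep shift_mx0 col_mx0 mul0mx addr0. Qed.

Lemma repE s t (i j : 'I_n) :
  rep s t i j = s ^+ (i - j) *+ ('C(i, j) * ((i < c)%N || (i == j)))
                + (j == 0 :> nat)%:R * col_mx 0 t i ord0.
Proof. by rewrite !mxE big_ord1 !mxE mulrC; congr (_ + _); case: (split i) => ?. Qed.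

(** A finite difference strictly lowers the degree; the bound on j says that the
    result has degree at most c - 2 and no component on the extra functions. *)
Lemma rep_sub1_eq0 s t (i j : 'I_n) : ~~ ((j < i) && (j.+1 < c))%N -> (rep s t - 1%:M) i j = 0.
Proof.
move=> h; rewrite mxE repE [X in _ + X]mxE [1%:M i j]mxE; move: h.
case: (ltngtP j i) => [ltji|ltij|/val_inj<-] /=.
- rewrite -leqNgt -(inj_eq val_inj) (gtn_eqF ltji) orbF subr0 => lecj.
  have := leq_trans lecj ltji; rewrite leqNgt => /negPf->; rewrite muln0 mulr0n add0r.
  have -> : (j == 0 :> nat) = false; last by rewrite mul0r.
  by case: (nat_of_ord j) lecj.
- rewrite -(inj_eq val_inj) (ltn_eqF ltij) subr0 bin_small // mul0n mulr0n add0r => _.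
  by rewrite (gtn_eqF (leq_ltn_trans (leq0n i) ltij)) mul0r.
- rewrite eqxx orbT subnn binn expr0 mulr1n => _.
  rewrite addrAC subrr add0r; case: eqP => [e|_]; last by rewrite mul0r.
  by rewrite mxE; case: splitP => k; rewrite ?mxE ?mulr0 // e.
Qed.

Lemma mul_rep0 b (P : 'M[R]_(b, n)) t :
  P *m (rep 0 t - 1%:M) = P *m col_mx 0 t *m const_row R.
Proof. by rewrite /rep shift_mx0 addrC addKr mulmxA. Qed.

(** (X + s) ^ k - X ^ k has leading term k * s * X ^ (k - 1). *)
Lemma mul_rep_lead b (P : 'M[R]_(b, n)) s i (j k : 'I_n) :
    (j.+1 < c)%N -> k = j.+1 :> nat -> (forall k' : 'I_n, (k < k')%N -> P i k' = 0) ->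
  (P *m (rep s 0 - 1%:M)) i j = s * P i k *+ k /\
  (forall j' : 'I_n, (j < j')%N -> (P *m (rep s 0 - 1%:M)) i j' = 0).
Proof.
move=> ltjc ejk P0; split=> [|j' ltjj']; last first.
  rewrite mxE big1 // => k' _; have [lek'|ltk'] := leqP k' k.
    rewrite rep_sub1_eq0 ?mulr0 // negb_and -leqNgt (leq_trans lek') //.
    by rewrite ejk.
  by rewrite P0 // mul0r.
rewrite mxE (bigD1 k) //= big1 ?addr0 => [|k' nk'].
  rewrite mxE repE [X in _ + X]mxE [1%:M _ _]mxE col_mx0 mxE mulr0 addr0.
  rewrite -(inj_eq val_inj) /= ejk ltjc /= muln1 (gtn_eqF (ltnSn _)) subr0.
  by rewrite subSnn expr1 binSn mulrnAr mulrC.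
have [lek'|ltk'] := ltnP k k'; first by rewrite P0 // mul0r.
rewrite rep_sub1_eq0 ?mulr0 // negb_and -leqNgt.
suff -> : (k' <= j)%N by [].
by rewrite -ltnS -ejk ltn_neqAle ltk' andbT (inj_eq val_inj).
Qed.

End Ring.

Lemma map_rep (R R' : comNzRingType) (f : {rmorphism R -> R'}) s t :
  map_mx f (rep s t) = rep (f s) (map_mx f t).
Proof.
apply/matrixP => i j; rewrite mxE !repE rmorphD rmorphM rmorphMn rmorphXn rmorph_nat.
by congr (_ + _ * _); rewrite !mxE; case: splitP => k _; rewrite !mxE ?rmorph0.
Qed.

Section Group.
Variables (b : nat) (R : comNzRingType).
Local Notation G := (shift_group l m g b R).
Implicit Types x y z : G.

Definition shift_mul x y : G := (x.1 + y.1, x.2 *m rep y.1.1 y.1.2 + y.2).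
Definition shift_one : G := (0, 0).
Definition shift_inv x : G := (- x.1, - (x.2 *m rep (- x.1.1) (- x.1.2))).

Lemma shift_mulA : associative shift_mul.
Proof.
move=> x y z; rewrite /shift_mul /= addrA; congr (_, _).
by rewrite repD mulmxDl mulmxA addrA.
Qed.

Lemma shift_mul1 : left_id shift_one shift_mul.
Proof. by move=> [y P]; rewrite /shift_mul /= add0r mul0mx add0r. Qed.

Lemma shift_mulr1 : right_id shift_one shift_mul.
Proof. by move=> [y P]; rewrite /shift_mul /= !addr0 rep0 mulmx1. Qed.

Lemma shift_mulV : left_inverse shift_one shift_inv shift_mul.
Proof.
move=> [[s t] P]; rewrite /shift_mul /shift_inv /= addNr; congr (_, _).
by rewrite mulNmx -mulmxA -repD !addNr rep0 mulmx1 addNr.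
Qed.

Lemma shift_mulrV : right_inverse shift_one shift_inv shift_mul.
Proof.
by move=> [[s t] P]; rewrite /shift_mul /shift_inv /= subrr; congr (_, _); rewrite subrr.
Qed.

HB.instance Definition _ := isGroup.Build (shift_group l m g b R)
  shift_mulA shift_mul1 shift_mulr1 shift_mulV shift_mulrV.

Local Open Scope group_scope.
Lemma shift_mulE x y : x * y = ((x.1 + y.1)%R, (x.2 *m rep y.1.1 y.1.2 + y.2)%R) :> G.
Proof. by []. Qed.
Lemma shift_invE x : x^-1 = ((- x.1)%R, (- (x.2 *m rep (- x.1.1) (- x.1.2)))%R) :> G.
Proof. by []. Qed.

(** Two elements over the same translation differ by an element of the module. *)
Lemma shift_divE x y : x.1 = y.1 -> x^-1 * y = (0%R, (y.2 - x.2)%R) :> G.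
Proof.
case: x y => [[s t] P] [y Q] /= <-.
rewrite shift_mulE /= addNr; congr (_, _).
by rewrite mulNmx -mulmxA -repD !addNr rep0 mulmx1 addrC.
Qed.

Lemma shift_commE x y :
  [~ x, y] = (0%R, (x.2 *m (rep y.1.1 y.1.2 - 1%:M)
                     - y.2 *m (rep x.1.1 x.1.2 - 1%:M))%R) :> G.
Proof.
rewrite /commg conjgE [x^-1 * _]mulgA -invMg shift_divE /=; last by rewrite addrC.
rewrite !mulmxBr !mulmx1; congr (_, _).
by rewrite !opprD opprK [(_ + y.2)%R in RHS]addrC [in RHS]addrACA [(- x.2 - _)%R]addrC.
Qed.

End Group.
End Rep.
HB.instance Definition _ l m g b (R : finComNzRingType) := Finite.on (shift_group l m g b R).

(** * The group of integer points: nilpotency, step length, irreducibility *)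

Section IntegerPoints.
Variables (l m : nat) (g : bool) (b : nat).
Local Notation n := (l.+2 + m)%N.
Local Notation c := (l.+2 + g)%N.
Local Notation G := (shift_group l m g b int).
Local Notation rep := (@rep l m g int).
Implicit Types (x y : G) (P : 'M[int]_(b, n)) (N : set G) (i : 'I_b).

Definition elt (s : int) (t : 'cV[int]_m) P : G := (s, t, P).
Definition module_elt P : G := (0, P).

Lemma module_eltD P Q : module_elt (P + Q) = (module_elt P * module_elt Q)%g.
Proof. by rewrite shift_mulE /= rep0 mulmx1 addr0. Qed.

Lemma module_elt0 : module_elt 0 = 1%g. Proof. by []. Qed.

Lemma module_eltX P k : (module_elt P ^+ k)%g = module_elt (P *+ k).
Proof.
elim: k => [|k IH]; first by rewrite expg0 mulr0n.
by rewrite expgS IH mulrS module_eltD.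
Qed.

Lemma module_elt_inj P Q : module_elt P = module_elt Q -> P = Q. Proof. by case. Qed.

Lemma comm_module P y : [~ module_elt P, y]%g = module_elt (P *m (rep y.1.1 y.1.2 - 1%:M)).
Proof. by rewrite shift_commE /= rep0 subrr mulmx0 subr0. Qed.

Lemma shift_expE x k : (x ^+ k)%g.1 = x.1 *+ k.
Proof. by elim: k => [|k IH]; rewrite ?expg0 ?mulr0n // expgS mulrS -IH. Qed.

Lemma mx_mulrn_eq0 p q (A : 'M[int]_(p, q)) k : A *+ k.+1 = 0 -> A = 0.
Proof.
move=> e; apply/matrixP => i j; rewrite mxE; apply/eqP.
have /eqP := congr1 (fun B : 'M[int]_(p, q) => B i j) e.
by rewrite mulmxnE mxE mulrn_eq0.
Qed.

Lemma shift_torsion_free : torsion_free G.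
Proof.
move=> [y P] [|k] // _ e.
have y0 : y = 0.
  move: (congr1 fst e); rewrite shift_expE /= => e1.
  rewrite [y]surjective_pairing; congr (_, _).
    by apply/eqP; move/(congr1 fst)/eqP: e1; rewrite raddfMn mulrn_eq0.
  by apply: (@mx_mulrn_eq0 _ _ _ k); move/(congr1 snd): e1; rewrite raddfMn.
move: e; rewrite y0 -/(module_elt P) module_eltX => /module_elt_inj/mx_mulrn_eq0 ->.
by [].
Qed.

Definition const_ix : 'I_n := lshift m ord0.
Definition linear_ix : 'I_n := lshift m (@Ordinal l.+2 1 isT).

Definition const_elt i (a : int) : G := module_elt (a *: delta_mx i const_ix).

Lemma delta_const_ix i : delta_mx i const_ix = delta_mx i ord0 *m const_row l m int.
Proof.
apply/matrixP => i' j; rewrite !mxE big_ord1 !mxE /= eqxx andbT -natrM mulnb.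
by rewrite -(inj_eq val_inj).
Qed.

Lemma rep_row1 (s : int) t j : (rep s t - 1%:M) linear_ix j = s * (j == const_ix)%:R.
Proof.
have [->|nj] := eqVneq j const_ix; last first.
  rewrite rep_sub1_eq0 ?mulr0 // negb_and -leqNgt /=.
  by rewrite lt0n; move: nj; rewrite -(inj_eq val_inj) /= => ->.
rewrite mxE repE [X in _ + X]mxE [1%:M _ _]mxE /= subr0.
by rewrite bin0 expr1 mulr1n mul1r col_mxEu mxE addr0 mulr1.
Qed.

Lemma mul_rep_row1 (v : 'cV[int]_b) s t :
  v *m delta_mx ord0 linear_ix *m (rep s t - 1%:M) = s *: v *m const_row l m int.
Proof.
apply/matrixP => i j; rewrite -mulmxA !mxE !big_ord1 !mxE (bigD1 linear_ix) //= big1 ?addr0.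
  by rewrite mxE !eqxx mul1r rep_row1 mulrCA mulrA -(inj_eq val_inj).
by move=> k nk; rewrite mxE (negPf nk) andbF mul0r.
Qed.

(** The function X is moved by the constant s. *)
Lemma comm_linear i x : [~ module_elt (delta_mx i linear_ix), x]%g = const_elt i x.1.1.
Proof.
have -> : delta_mx i linear_ix = (delta_mx i ord0 : 'cV[int]_b) *m delta_mx ord0 linear_ix.
  by rewrite mul_delta_mx.
rewrite comm_module.
by rewrite mul_rep_row1 -scalemxAl -delta_const_ix.
Qed.

(** When s = 0, the k-th extra function is moved by the constant [t k]. *)
Lemma comm_extra i k x : x.1.1 = 0 ->
  [~ module_elt (delta_mx i (rshift l.+2 k)), x]%g = const_elt i (x.1.2 k ord0).
Proof.
move=> s0; rewrite comm_module s0 mul_rep0; congr module_elt.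
rewrite delta_const_ix scalemxAl; congr (_ *m _); apply/matrixP=> i' j.
rewrite mxE (bigD1 (rshift l.+2 k)) //= big1 ?addr0 => [|k' nk].
  by rewrite col_mxEd !mxE !ord1 !eqxx !andbT mulrC.
by rewrite mxE (negPf nk) andbF mul0r.
Qed.

(** Taking j successive finite differences of a polynomial of degree j leaves j!
    times its leading coefficient. *)
Lemma normal_lead N (j : 'I_n) P : normal_subgroup N -> (j < c)%N ->
  (forall i (k : 'I_n), (j < k)%N -> P i k = 0) -> N (module_elt P) ->
  N (module_elt ((col j P *+ j`!) *m const_row l m int)).
Proof.
move=> nN; move ej: (nat_of_ord j) => d; elim: d j P ej => [|d IH] j P ej ltjc P0 NP.
  rewrite fact0 mulr1n (_ : _ *m _ = P) //; apply/matrixP => i k; rewrite !mxE big_ord1 !mxE.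
  case: eqP => [ek|/eqP nk]; last by rewrite mulr0 P0 // lt0n.
  by rewrite mulr1; congr (P _ _); apply/val_inj; rewrite /= ej ek.
have dn : (d < n)%N by rewrite ltnW // -ej.
pose j' : 'I_n := Ordinal dn.
pose M := P *m (rep 1 0 - 1%:M).
have lead i : M i j' = P i j *+ j /\ forall k : 'I_n, (j' < k)%N -> M i k = 0.
  have Pj (k : 'I_n) : (j < k)%N -> P i k = 0 by rewrite ej; apply: P0.
  by have [h1 h2] := @mul_rep_lead l m g int b P 1 i j' j ltjc ej Pj; rewrite mul1r in h1.
have NM : N (module_elt M).
  by rewrite -[module_elt M](comm_module P (elt 1 0 0)); apply: normal_commr.
have := IH j' M erefl _ (fun i => (lead i).2) NM.
rewrite (_ : col j' M *+ _ = col j P *+ d.+1`!); first by apply; rewrite /= ltnW // -ej.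
apply/matrixP => i k; rewrite !mulmxnE [col j' M _ _]mxE [col j P _ _]mxE (lead i).1.
by rewrite ej -mulrnA factS.
Qed.

Definition shift_gens : seq G :=
  elt 1 0 0 :: [seq elt 0 (delta_mx k ord0) 0 | k : 'I_m] ++
    [seq module_elt (delta_mx ij.1 ij.2) | ij : 'I_b * 'I_n].

Lemma shift_generates : generates shift_gens.
Proof.
apply/seteqP; split=> // -[[s t] P] _.
have sH := generated_subgroup [set` shift_gens].
have gen x : x \in shift_gens -> Defs.generated [set` shift_gens] x.
  by move=> xS; apply: sub_generated.
have -> : (s, t, P) = (elt s 0 0 * elt 0 t 0 * module_elt P)%g :> G.
  rewrite !shift_mulE /= !(mul0mx, add0r, addr0); congr (_, _).
  by rewrite -[RHS]/(_ + _, _ + _) addr0 add0r.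
apply: (subgroupM sH); first apply: (subgroupM sH).
- apply: (subgroup_int_hom (f := fun s => elt s 0 0)) => // [s1 s2|].
    by rewrite !shift_mulE /= mul0mx !addr0; congr (_, _); rewrite -[RHS]/(_ + _, _ + _) addr0.
  by apply: gen; rewrite inE eqxx.
- apply: (subgroup_mx_hom (f := fun t => elt 0 t 0)) => // [t1 t2|k j].
    by rewrite !shift_mulE /= mul0mx !addr0; congr (_, _); rewrite -[RHS]/(_ + _, _ + _) addr0.
  apply: gen; rewrite inE mem_cat ord1; apply/orP; right; apply/orP; left.
  by apply/mapP; exists k; rewrite // mem_enum.
- apply: (subgroup_mx_hom (f := module_elt)) => // [P1 P2|i j]; first exact: module_eltD.
  apply: gen; rewrite inE mem_cat; apply/orP; right; apply/orP; right.
  by apply/mapP; exists (i, j); rewrite // mem_enum.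
Qed.

Lemma shift_finitely_generated : finitely_generated G.
Proof. by exists shift_gens; apply: shift_generates. Qed.

(** The first commutator lands in degree at most c - 2, and each further one lowers
    the degree. *)
Lemma lower_central_sub k x : @lower_central G k.+1 x ->
  x.1 = 0 /\ forall i (j : 'I_n), (c <= j + k.+1)%N -> x.2 i j = 0.
Proof.
pose L k : set G := [set x : G | x.1 = 0 /\ forall i (j : 'I_n), (c <= j + k.+1)%N -> x.2 i j = 0].
have sL k' : is_subgroup (L k').
  split=> [|y z [y1 y0] [z1 z0]|y [y1 y0]].
  - by split=> // i j _; rewrite mxE.
  - split=> [|i j h]; rewrite shift_mulE /= ?y1 z1 ?addr0 //=.
    by rewrite rep0 mulmx1 mxE y0 // z0 // addr0.
  - split=> [|i j h]; rewrite shift_invE /= y1 ?oppr0 //=.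
    by rewrite rep0 mulmx1 mxE y0 // oppr0.
rewrite -/(L k x); elim: k x => [|k IH] x; apply: generated_sub (sL _) _ x => _ [x [y [lx ->]]].
  split; first by rewrite shift_commE.
  move=> i j; rewrite addn1 => cj; rewrite shift_commE !mxE !big1 ?subr0 // => k _.
    by rewrite rep_sub1_eq0 ?mulr0 // negb_and -!leqNgt cj orbT.
  by rewrite rep_sub1_eq0 ?mulr0 // negb_and -!leqNgt cj orbT.
have [x1 x0] := IH _ lx.
split=> [|i j cj]; rewrite shift_commE //= x1 rep0 subrr mulmx0 subr0 mxE big1 // => k' _.
have [le|lt] := leqP c (k' + k.+1); first by rewrite x0 // mul0r.
rewrite rep_sub1_eq0 ?mulr0 // negb_and -!leqNgt.
suff -> : (k' <= j)%N by [].
by move: cj lt; lia.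
Qed.

Lemma lower_central_step : @lower_central G c = [set 1%g].
Proof.
apply/seteqP; split=> [x|_ ->]; last first.
  rewrite -[c]/(l.+1 + g).+1; apply: subgroup1; exact: generated_subgroup.
rewrite -[c]/(l.+1 + g).+1 => /lower_central_sub[x1 x0].
rewrite /= [x]surjective_pairing x1; congr (_, _); apply/matrixP => i j.
by rewrite x0 ?mxE // leq_addl.
Qed.

Lemma shift_nilpotent : nilpotent_group G.
Proof. by exists c; apply: lower_central_step. Qed.

(** Iterated differences of the basis vector c - 1, of degree c - 1 in X, do not
    vanish before the c-th. With gluing that vector is the first extra function,
    so one must exist. *)
Lemma lower_central_neq1 k : (0 < b)%N -> (g -> 0 < m)%N -> (k < c)%N ->
  @lower_central G k <> [set 1%g].
Proof.
move=> b0 hg ltkc; pose i := Ordinal b0.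
have cn : (c <= n)%N by rewrite leq_add2l; case: (g) hg => // ->.
have dn : (c - k.+1 < n)%N by apply: leq_trans cn; lia.
suff [P [PL Pi P0]] : exists P, [/\ lower_central k (module_elt P), P i (Ordinal dn) <> 0 &
   forall j : 'I_n, (c - k.+1 < j)%N -> P i j = 0].
  by move=> L1; move: PL; rewrite L1 => /module_elt_inj e; apply: Pi; rewrite e mxE.
elim: k ltkc dn => [|k IH] ltkc dn.
  exists (delta_mx i (Ordinal dn)); split=> //; first by rewrite mxE !eqxx.
  by move=> j h; rewrite mxE; case: (j =P _) => [ej|_]; rewrite ?andbF // ej ltnn in h.
have dn' : (c - k.+1 < n)%N by apply: leq_trans cn; lia.
have [P [PL Pi P0]] := IH (ltnW ltkc) dn'.
pose j := Ordinal dn; pose j' := Ordinal dn'.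
have ltjc : (j.+1 < c)%N by rewrite /=; lia.
have ej : j' = j.+1 :> nat by rewrite /=; lia.
have [h1 h2] := @mul_rep_lead l m g int b P 1 i j j' ltjc ej P0.
exists (P *m (rep 1 0 - 1%:M)); split.
- rewrite -[module_elt _](comm_module P (elt 1 0 0)); apply: sub_generated.
  by exists (module_elt P), (elt 1 0 0).
- rewrite h1 mul1r; apply/eqP; rewrite mulrn_eq0 negb_or; apply/andP; split.
    by rewrite ej.
  exact/eqP.
- exact: h2.
Qed.

Lemma shift_step_length : (0 < b)%N -> (g -> 0 < m)%N -> step_length G = c.
Proof.
move=> b0 hg; rewrite /step_length.
have [h1 h2] := @nat_minP [set k | @lower_central G k = [set 1%g]]
   (ex_intro _ c lower_central_step).
apply/eqP; rewrite eqn_leq h2 /=; last exact: lower_central_step.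
by rewrite leqNgt; apply/negP => /(lower_central_neq1 b0 hg).
Qed.

Lemma comm_module_extra P k :
  [~ module_elt P, elt 0 (delta_mx k ord0) 0]%g =
  module_elt (col (rshift l.+2 k) P *m const_row l m int).
Proof.
rewrite comm_module mul_rep0; congr module_elt; congr (_ *m _).
apply/matrixP => i j; rewrite mxE (bigD1 (rshift l.+2 k)) //= big1 ?addr0 => [|k' nk].
  by rewrite col_mxEd !mxE !ord1 !eqxx mulr1.
rewrite mxE; case: splitP => k'' e; first by rewrite mxE mulr0.
rewrite mxE; case: (k'' =P k) => [ek|_]; last by rewrite andFb mulr0.
by case/eqP: nk; apply/val_inj; rewrite /= e ek.
Qed.

Lemma const_elt_mul N i (a k : int) : is_subgroup N -> N (const_elt i a) ->
  N (const_elt i (k * a)).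
Proof.
move=> sN Na; apply: (subgroup_int_hom (f := fun k => const_elt i (k * a))) => // [x y|].
  by rewrite /const_elt -module_eltD mulrDl scalerDl.
by rewrite mul1r.
Qed.

(** An element that moves the affine space moves a coordinate function by a non-zero
    constant, which is a commutator. *)
Lemma normal_meets_center N i : normal_subgroup N -> ~ N `<=` [set x : G | x.1 = 0] ->
  exists2 a, a != 0 & N (const_elt i a).
Proof.
move=> nN /existsNP[x /not_implyP[Nx /= x0]].
have [s0|s0] := eqVneq x.1.1 0; last first.
  by exists x.1.1; rewrite // -comm_linear; apply: normal_comml.
suff [k tk] : exists k, x.1.2 k ord0 != 0.
  by exists (x.1.2 k ord0); rewrite // -comm_extra //; apply: normal_comml.
apply: contrapT => /forallNP t0; apply: x0; rewrite [x.1]surjective_pairing s0.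
congr (_, _); apply/colP => k; rewrite mxE; apply/eqP/negPn/negP; exact: t0.
Qed.

(** The extra functions are detected by translations along them, and a polynomial
    of positive degree has a non-zero difference. *)
Lemma central_const P : (forall y, commute (module_elt P) y) ->
  P = col const_ix P *m const_row l m int.
Proof.
move=> cP; have P0 s t : P *m (rep s t - 1%:M) = 0.
  have /commgP/eqP := cP (elt s t 0).
  by rewrite comm_module -module_elt0 => /module_elt_inj.
suff h i (j : 'I_n) : j != const_ix -> P i j = 0.
  apply/matrixP => i j; rewrite mxE big_ord1 !mxE.
  have [->|nj] := eqVneq j const_ix; first by rewrite mulr1.
  by rewrite h //; move: nj; rewrite -(inj_eq val_inj) => /negPf /= ->; rewrite mulr0.
have P0r k : P i (rshift l.+2 k) = 0.
  have /commgP/eqP := cP (elt 0 (delta_mx k ord0) 0).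
  rewrite comm_module_extra -module_elt0 => /module_elt_inj.
  move/(congr1 (fun A : 'M[int]_(b, n) => A i const_ix)).
  by rewrite mxE big_ord1 !mxE mulr1.
move=> nj; apply/eqP/negPn/negP => Pj.
pose A := fun j : 'I_n => (j != const_ix) && (P i j != 0).
have Aj : A j by apply/andP.
case: (@arg_maxnP _ j A (@nat_of_ord n) Aj) => k /andP[nk Pk] mx.
have k0 : (0 < k)%N by rewrite lt0n; move: nk; rewrite -(inj_eq val_inj).
have kl : (k < l.+2)%N.
  rewrite ltnNge; apply/negP => lk; case/eqP: Pk.
  have kk : (k - l.+2 < m)%N by rewrite ltn_subLR.
  by rewrite -(P0r (Ordinal kk)); congr (P _ _); apply/val_inj; rewrite /= subnKC.
have kc : (k < c)%N by rewrite (leq_trans kl) // leq_addr.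
have dk : (k.-1 < n)%N by rewrite (leq_ltn_trans (leq_pred _)).
have kz (k' : 'I_n) : (k < k')%N -> P i k' = 0.
  move=> lt; apply/eqP/negPn/negP => Pk'.
  suff lek : (k' <= k)%N by rewrite ltnNge lek in lt.
  by apply: mx; rewrite /A Pk' andbT -(inj_eq val_inj) /= -lt0n (leq_ltn_trans _ lt).
have [] := @mul_rep_lead l m g int b P 1 i (Ordinal dk) k _ _ kz; rewrite /= ?prednK //.
rewrite P0 mxE mul1r => /esym/eqP; rewrite mulrn_eq0 (negPf Pk) orbF.
by rewrite (gtn_eqF k0).
Qed.

Lemma shift_irreducible : (0 < b)%N -> irreducible G.
Proof.
move=> b0; apply: (@irreducible_criterion _ [set x : G | x.1 = 0]).
- move=> N N' nN nN' /(normal_meets_center (Ordinal b0) nN)[a a0 Na].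
  move=> /(normal_meets_center (Ordinal b0) nN')[a' a'0 Na'].
  exists (const_elt (Ordinal b0) (a' * a)); split.
  + move/module_elt_inj/matrixP/(_ (Ordinal b0) const_ix)/eqP; rewrite !mxE !eqxx mulr1.
    by rewrite mulf_eq0 (negPf a0) (negPf a'0).
  + by apply: const_elt_mul Na; case: nN.
  + by rewrite mulrC; apply: const_elt_mul Na'; case: nN'.
- move=> [y P] [y' P'] /= -> ->.
  by rewrite /commute -[(0, P)]/(module_elt P) -[(0, P')]/(module_elt P') -!module_eltD addrC.
(* The constant p is the difference of p X. *)
- move=> [y P] /= -> /central_const e.
  exists (module_elt (col const_ix P *m delta_mx ord0 linear_ix)), (elt 1 0 0).
  by rewrite comm_module mul_rep_row1 scale1r -e.
Qed.

End IntegerPoints.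

(** * Hirsch lengths of the translation groups, and the infinite cyclic group *)

Section PolycyclicShift.
Local Open Scope group_scope.
Section ShiftHirsch.
Variables (l m : nat) (g : bool) (b : nat).
Local Notation n := (l.+2 + m)%N.
Local Notation G := (shift_group l m g b int).

(** The module comes first: its elements commute, so any order of its coordinates
    gives a series. *)
Definition shift_coord (x : G) : 'rV[int]_(b * n + m + 1) :=
  row_mx (row_mx (mxvec x.2) x.1.2^T) x.1.1%:M.

Lemma shift_polycyclic : exists N (F : nat -> set G), polycyclic_series N F.
Proof.
exists (b * n + m + 1)%N, (coord_series shift_coord); apply: coord_polycyclic.
- move=> i x y; rewrite shift_mulE /shift_coord.
  case: (split_ordP i) => [j ->|j ->]; last by rewrite !row_mxEr !mxE mulrnDl.
  case: (split_ordP j) => [k ->|k ->]; last by rewrite !row_mxEl !row_mxEr !mxE.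
  move=> hx hy; rewrite !row_mxEl.
  have z (u : G) : coord_series shift_coord (lshift 1 (lshift m k)).+1 u -> u.1 = 0%R.
    move=> hu; rewrite [u.1]surjective_pairing; congr (_, _).
      have := hu (rshift _ ord0); rewrite /shift_coord row_mxEr mxE eqxx mulr1n; apply.
      by rewrite /= addn0 ltn_addr.
    apply/colP => j'; have := hu (lshift 1 (rshift _ j')).
    rewrite /shift_coord row_mxEl row_mxEr !mxE; apply.
    by rewrite /= ltn_addr.
  by rewrite (z y hy) /= rep0 mulmx1 linearD mxE.
- move=> [[s t] P]; rewrite /shift_coord -[RHS]row_mx0 -[X in row_mx X _ = _]/(row_mx _ _).
  move=> /eq_row_mx[]; rewrite -row_mx0 => /eq_row_mx[/= eP et] es.
  have -> : s = 0%R by have := congr1 (fun A : 'M[int]_1 => A ord0 ord0) es; rewrite !mxE.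
  have -> : t = 0%R by rewrite -[t]trmxK et trmx0.
  by rewrite -[P]mxvecK eP linear0.
- move=> i; pose d : 'rV[int]_(b * n + m + 1) := delta_mx ord0 i.
  exists (elt g (rsubmx d ord0 ord0) (rsubmx (lsubmx d))^T (vec_mx (lsubmx (lsubmx d)))).
  rewrite /shift_coord /= vec_mxK trmxK hsubmxK -[RHS]hsubmxK; congr row_mx.
  by rewrite [RHS]mx11_scalar.
Qed.

Lemma shift_hirsch_length : (b * n <= hirsch_length G)%N.
Proof.
apply: (@hirsch_length_ge _ _ (fun v => module_elt g (vec_mx v))); first exact: shift_polycyclic.
  by move=> u v; rewrite linearD module_eltD.
by move=> v /module_elt_inj/(congr1 mxvec); rewrite vec_mxK => ->; rewrite linear0.
Qed.

End ShiftHirsch.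

(** For b = m = 0 only the translation s along X is left, an integer. *)
Section Integers.
Local Notation Z := (shift_group 0 0 false 0 int).

Lemma integers_eta (x : Z) : x = elt false x.1.1 0 0.
Proof.
by case: x => [[s t] P]; rewrite /elt /= (flatmx0 t) (flatmx0 P).
Qed.

Lemma integers_mul (a a' : int) :
  elt false (a + a')%R 0 0 = elt false a 0 0 * elt false a' 0 0 :> Z.
Proof. by rewrite [RHS]integers_eta. Qed.

Lemma integers_irreducible : irreducible Z.
Proof.
have Zc (x y : Z) : commute x y.
  by rewrite (integers_eta x) (integers_eta y) /commute -!integers_mul addrC.
apply: (@irreducible_criterion _ [set 1]); last first.
- by move=> _ -> _; exists 1, 1; rewrite comm1g.
- by move=> x y _ _.
move=> N N' [sN _] [sN' _] /existsNP[x /not_implyP[Nx x1]] /existsNP[y /not_implyP[Ny y1]].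
have mul (M : set Z) (u : Z) (k : int) : is_subgroup M -> M u -> M (elt false (k * u.1.1)%R 0 0).
  move=> sM Mu; apply: (subgroup_int_hom (f := fun k => elt false (k * u.1.1)%R 0 0)) => // [a a'|].
    by rewrite mulrDl integers_mul.
  by rewrite mul1r -integers_eta.
exists (elt false (x.1.1 * y.1.1)%R 0 0); split.
- case=> /eqP; rewrite mulf_eq0 => /orP[] /eqP e.
    by apply: x1; rewrite (integers_eta x) e.
  by apply: y1; rewrite (integers_eta y) e.
- by rewrite mulrC; apply: mul.
- exact: mul.
Qed.

Lemma integers_hirsch_length : (1 <= hirsch_length Z)%N.
Proof.
apply: (@hirsch_length_ge _ _ (fun v : 'rV[int]_1 => elt false (v ord0 ord0) 0 0 : Z)).
- exact: shift_polycyclic.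
- by move=> u v; rewrite mxE integers_mul.
- by move=> v [e]; apply/rowP => j; rewrite mxE ord1.
Qed.

Lemma integers_step_length : step_length Z = 1%N.
Proof.
have L1 : @lower_central Z 1 = [set 1].
  apply/seteqP; split=> [x /lower_central_sub[x1 _]|_ ->]; last first.
    exact: (subgroup1 (generated_subgroup _)).
  by rewrite /= (integers_eta x) x1.
rewrite /step_length.
have [h1 h2] := @nat_minP [set k | @lower_central Z k = [set 1]] (ex_intro _ 1%N L1).
have := h2 _ L1; case: (nat_min _) h1 => [|[]] //= e.
have : [set: Z] (elt false 1 0 0) by [].
by rewrite e => -[].
Qed.

End Integers.
End PolycyclicShift.

(** * Detection by quotients of logarithmic order *)

Section Height.
Variables (l m : nat) (g : bool) (b : nat).
Local Notation n := (l.+2 + m)%N.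
Local Notation G := (shift_group l m g b int).
Implicit Types (x y : G) (B K : int) (S : seq G).

Definition height_le B x : Prop :=
  [/\ `|x.1.1| <= B, forall k, `|x.1.2 k ord0| <= B & forall i j, `|x.2 i j| <= B].

Lemma height_leW B K x : B <= K -> height_le B x -> height_le K x.
Proof.
by move=> BK [h1 h2 h3]; split=> [|k|i j]; apply: le_trans BK.
Qed.

Lemma height_exists x : exists2 B, 1 <= B & height_le B x.
Proof.
pose T := \sum_k `|x.1.2 k ord0|; pose U := \sum_i \sum_j `|x.2 i j|.
have T0 : 0 <= T by apply: sumr_ge0.
have U0 : 0 <= U by apply: sumr_ge0 => i _; apply: sumr_ge0.
exists (1 + `|x.1.1| + T + U); first by rewrite -!addrA lerDl !addr_ge0.
split=> [|k|i j].
- by rewrite -addrA -addrA addrCA lerDl !addr_ge0.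
- have : `|x.1.2 k ord0| <= T by rewrite /T (bigD1 k) //= lerDl sumr_ge0.
  by move/le_trans; apply; rewrite addrAC lerDr !addr_ge0.
- have : `|x.2 i j| <= U.
    rewrite /U (bigD1 i) //= (bigD1 j) //= -addrA lerDl addr_ge0 //; first by apply: sumr_ge0.
    by apply: sumr_ge0 => i' _; apply: sumr_ge0.
  by move/le_trans; apply; rewrite lerDr !addr_ge0.
Qed.

Lemma gens_height S : exists2 K, 1 <= K & forall x, x \in S \/ (x^-1)%g \in S -> height_le K x.
Proof.
elim: S => [|y S [K K1 hK]]; first by exists 1 => // x [].
have [B B1 hB] := height_exists y; have [B' B'1 hB'] := height_exists (y^-1)%g.
exists (K + (B + B')); first by rewrite (le_trans K1) // lerDl addr_ge0 // (le_trans ler01).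
have K0 := le_trans ler01 K1; have B0 := le_trans ler01 B1; have B'0 := le_trans ler01 B'1.
move=> x; rewrite !inE => -[/orP[/eqP->|xS]|/orP[/eqP e|xS]].
- by apply: height_leW hB; rewrite addrCA lerDl addr_ge0.
- by apply: height_leW (hK _ (or_introl xS)); rewrite lerDl addr_ge0.
- by rewrite -[x]invgK e; apply: height_leW hB'; rewrite addrA lerDr addr_ge0.
- by apply: height_leW (hK _ (or_intror xS)); rewrite lerDl addr_ge0.
Qed.

Lemma rep_bound B (s : int) (t : 'cV[int]_m) (i j : 'I_n) : 1 <= B ->
  `|s| <= B -> (forall k, `|t k ord0| <= B) ->
  `|rep l g s t i j| <= (2 ^+ n + 1) * B ^+ n.
Proof.
move=> B1 hs ht; have B0 := le_trans ler01 B1.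
rewrite repE (le_trans (ler_normD _ _)) // [leRHS]mulrDl mul1r lerD //.
  rewrite normrMn normrX -[leLHS]mulr_natl.
  have hC : ((('C(i, j) * ((i < l.+2 + g)%N || (i == j)))%:R : int) <= 2 ^+ n).
    rewrite -natrX ler_nat; apply: (@leq_trans (2 ^ i)); last first.
      by rewrite leq_exp2l // ltnW.
    apply: (@leq_trans 'C(i, j)); first by case: (_ || _); rewrite ?muln1 ?muln0.
    exact: bin_le_two_exp.
  apply: ler_pM; rewrite ?ler0n ?exprn_ge0 //.
  apply: (@le_trans _ _ (B ^+ (i - j))); first by rewrite lerXn2r // ?nnegrE.
  by rewrite ler_weXn2l // (leq_trans (leq_subr _ _)) // ltnW.
have h1 : B <= B ^+ n by rewrite -{1}[B]expr1 ler_weXn2l.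
apply: le_trans h1; rewrite normrM normr_nat.
have : `|col_mx (0 : 'cV_l.+2) t i ord0| <= B.
  by rewrite mxE; case: splitP => k _; rewrite ?mxE ?normr0.
by case: (_ == _); rewrite ?mul1r ?mul0r.
Qed.

(** The translation part of a word is a sum of translation parts of letters. Hence
    the module part is a sum of module parts of letters, each transformed by a
    single matrix [rep s t] with s and t linearly bounded in the length. *)
Lemma word_height S : exists2 C, 1 <= C & forall w, is_word S w ->
  height_le (C * ((size w).+1%:R) ^+ n.+1) (\prod_(x <- w) x)%g.
Proof.
have [K K1 hK] := gens_height S; have K0 := le_trans ler01 K1.
(* C0 * k ^ n bounds the contribution of one letter to the module part of a word
   of length k. *)
pose C0 : int := n%:R * (K * ((2 ^+ n + 1) * K ^+ n)).
have C00 : 0 <= C0.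
  by rewrite mulr_ge0 // mulr_ge0 // mulr_ge0 ?exprn_ge0 // addr_ge0 // exprn_ge0.
have key w : is_word S w -> let x : G := (\prod_(x <- w) x)%g in
    [/\ `|x.1.1| <= K * (size w)%:R, forall k, `|x.1.2 k ord0| <= K * (size w)%:R &
        forall i j, `|x.2 i j| <= (size w)%:R * (C0 * (size w).+1%:R ^+ n)].
  elim: w => [_|a w IH hw] /=.
    rewrite big_nil; split=> [|k|i j]; rewrite /= ?mxE normr0 ?mulr0 ?mul0r //.
  rewrite big_cons; set X := (\prod_(x <- w) x)%g in IH *.
  have [|h1 h2 h3] := IH; first by move=> x xw; apply: hw; rewrite inE xw orbT.
  have [a1 a2 a3] := hK a (hw a (mem_head _ _)).
  have Ek : K * (size w).+1%:R = K + K * (size w)%:R by rewrite -natr1 mulrDr mulr1 addrC.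
  rewrite shift_mulE /=; split=> [|k|i j].
  - by rewrite Ek (le_trans (ler_normD _ _)) // lerD.
  - by rewrite mxE Ek (le_trans (ler_normD _ _)) // lerD.
  have -> Y : (size w).+1%:R * Y = Y + (size w)%:R * Y :> int by rewrite -natr1 mulrDl mul1r addrC.
  rewrite mxE.
  apply: le_trans (ler_normD _ _) _; apply: lerD; last first.
    apply: le_trans (h3 i j) _; rewrite ler_wpM2l // ler_wpM2l //.
    by rewrite lerXn2r // ?nnegrE // ler_nat.
  apply: (@le_trans _ _ (C0 * (size w).+1%:R ^+ n)); last first.
    by rewrite ler_wpM2l // lerXn2r // ?nnegrE // ler_nat.
  rewrite mxE; apply: le_trans (ler_norm_sum _ _ _) _.
  rewrite /C0 -mulrA mulr_natl -[X in _ *+ X]card_ord -sumr_const.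
  apply: ler_sum => k _; rewrite normrM -mulrA ler_pM // -mulrA -exprMn.
  have hle : K * (size w)%:R <= K * (size w).+1%:R by rewrite ler_wpM2l // ler_nat.
  apply: rep_bound => [||k'].
  - by rewrite (le_trans K1) // ler_peMr // ler1n.
  - exact: le_trans h1 hle.
  - exact: le_trans (h2 k') hle.
exists (K + C0) => [|w hw]; first by rewrite (le_trans K1) // lerDl.
have [h1 h2 h3] := key w hw; set k := size w in h1 h2 h3 *.
have q1 : (1 : int) <= k.+1%:R by rewrite ler1n.
have b1 : K * k%:R <= (K + C0) * k.+1%:R ^+ n.+1.
  apply: ler_pM => //; first by rewrite lerDl.
  apply: (@le_trans _ _ k.+1%:R); first by rewrite ler_nat.
  by rewrite -{1}[k.+1%:R]expr1 ler_weXn2l.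
split=> [|k'|i j]; try exact: le_trans b1.
apply: le_trans (h3 i j) _; rewrite exprS [leRHS]mulrCA.
apply: ler_pM; rewrite ?ler_nat //; first by rewrite mulr_ge0 // exprn_ge0.
by rewrite ler_wpM2r ?exprn_ge0 // lerDr.
Qed.

End Height.

Section Reduction.
Variables (l m : nat) (g : bool) (b b' q : nat) (r : 'I_b' -> 'I_b).
Local Notation n := (l.+2 + m)%N.
Local Notation toZq := (intr : int -> 'Z_q).

(** The map [r] selects the copies of the module that are kept. *)
Definition reduction (x : shift_group l m g b int) : shift_group l m g b' 'Z_q :=
  (toZq x.1.1, map_mx toZq x.1.2, map_mx toZq (rowsub r x.2)).

Lemma reductionM : {morph reduction : x y / (x * y)%g}.
Proof.
move=> x y; rewrite /reduction !shift_mulE /=; congr (_, _).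
  by congr (_, _); rewrite ?rmorphD ?map_mxD.
by rewrite -map_rep -map_mxM -map_mxD; congr map_mx; rewrite raddfD /= mul_rowsub_mx.
Qed.
HB.instance Definition _ := isMultiplicative.Build _ _ reduction reductionM.

Lemma reduction_surj : injective r -> forall y, exists x, reduction x = y.
Proof.
move=> rI [[s t] P].
pose lift (z : 'Z_q) : int := (z : nat)%:Z.
have liftK z : toZq (lift z) = z by rewrite /lift -pmulrn natr_Zp.
exists (lift s, map_mx lift t,
  \matrix_(i, j) if [pick k | r k == i] is Some k then lift (P k j) else 0).
rewrite /reduction /= liftK; congr (_, _, _).
  by apply/matrixP => i j; rewrite !mxE liftK.
apply/matrixP => i j; rewrite !mxE.
by case: pickP => [k /eqP/rI ->|/(_ i)]; rewrite ?liftK // eqxx.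
Qed.

Lemma card_shift_group : (1 < q)%N ->
  #|{: shift_group l m g b' 'Z_q}| = (q ^ (1 + m + b' * n))%N.
Proof.
move=> q1; rewrite !card_prod !card_mx card_ord (Zp_cast q1) muln1.
by rewrite -{1}[q]expn1 -!expnD.
Qed.

End Reduction.

Lemma intr_Zq_eq0 q (a : int) : (1 < q)%N -> (a%:~R == 0 :> 'Z_q) = (q %| `|a|)%N.
Proof.
move=> q1; have hn (k : nat) : (k%:R == 0 :> 'Z_q) = (q %| k)%N.
  by rewrite -val_eqE /= val_Zp_nat.
by case: a => k; rewrite ?NegzE ?mulrNz ?oppr_eq0 -pmulrn hn.
Qed.

Section Upper.
Variables (l m : nat) (g : bool) (b : nat).
Local Notation n := (l.+2 + m)%N.
Local Notation G := (shift_group l m g b int).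
Local Notation D := (1 + m + (0 < b) * n)%N.

Lemma reduction_detects b' (r : 'I_b' -> 'I_b) q (x : G) : injective r -> (1 < q)%N ->
  reduction q r x <> 1%g -> detects x (q ^ (1 + m + b' * n))%N.
Proof.
move=> rI q1 x1; exists (shift_group l m g b' 'Z_q), (reduction q r : {multiplicative _ -> _}).
split=> //; first exact: reduction_surj.
by rewrite -(card_shift_group l m g b' q1); apply: eq_card.
Qed.

(** A coordinate in row i of the module survives in the quotient that keeps that row
    only; a coordinate of the translation survives whichever rows are kept. *)
Lemma coordinate_detects (x : G) : x <> 1%g -> exists a : int, [/\ a != 0,
  forall B, height_le B x -> `|a| <= B &
  forall q, (1 < q)%N -> ~~ (q %| `|a|)%N -> detects x (q ^ D)%N].
Proof.
move=> x1.
have det (q : nat) (i : 'I_b) : (1 < q)%N -> reduction q (fun _ : 'I_1 => i) x <> 1%g ->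
    detects x (q ^ D)%N.
  move=> q1; have -> : (0 < b)%N by apply: leq_ltn_trans (ltn_ord i).
  by apply: reduction_detects => // u v _; rewrite !ord1.
have det0 (q : nat) : (1 < q)%N ->
    (x.1.1%:~R != 0 :> 'Z_q) \/ (exists k, (x.1.2 k ord0)%:~R != 0 :> 'Z_q) -> detects x (q ^ D)%N.
  move=> q1 hx.
  have red1 b' (r : 'I_b' -> 'I_b) : reduction q r x <> 1%g.
    case=> es /colP et _; case: hx => [/negP|[k /negP]]; apply; first by rewrite es.
    by have := et k; rewrite !mxE => ->.
  have [b0|b0] := posnP b; last first.
    by have := det q (Ordinal b0) q1 (red1 _ _); rewrite b0.
  have r0 : 'I_0 -> 'I_b by case.
  by apply: (@reduction_detects 0 r0) => // -[].
have [s0|s0] := eqVneq x.1.1 0; last first.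
  exists x.1.1; split=> // [B []//|q q1 nq]; apply: det0 => //.
  by left; rewrite intr_Zq_eq0.
have [[k tk]|/forallNP t0] := pselect (exists k, x.1.2 k ord0 != 0).
  exists (x.1.2 k ord0); split=> // [B []//|q q1 nq]; apply: det0 => //.
  by right; exists k; rewrite intr_Zq_eq0.
have [[i [j Pij]]|P0] := pselect (exists i j, x.2 i j != 0).
  exists (x.2 i j); split=> // [B []//|q q1 nq]; apply: (det q i) => //.
  move=> e; case/negP: nq; rewrite -intr_Zq_eq0 //.
  by move: (congr1 snd e) => /matrixP/(_ ord0 j); rewrite !mxE => ->.
case: x1; rewrite [x]surjective_pairing [x.1]surjective_pairing s0.
congr (_, _, _).
  by apply/colP => k; rewrite mxE; apply/eqP/negPn/negP; apply: t0.
by apply/matrixP => i j; rewrite mxE; apply/eqP/negPn/negP => h; apply: P0; exists i, j.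
Qed.

(** A non-zero integer bounded by a power of N has a non-divisor bounded by a
    multiple of log N. *)
Lemma detection_upper (S : seq G) : generates S -> exists c0, forall N x,
  (0 < N)%N -> x <> 1%g -> (word_length S x <= N)%N ->
  exists2 q, (q <= (c0 * (trunc_log 2 N).+1) ^ D)%N & detects x q.
Proof.
move=> gS; have [C C1 hC] := word_height S.
exists ((`|C|%N + n.+2) * 2)%N => N x N0 x1 xN.
have [a [a0 aB adet]] := coordinate_detects x1.
have ha0 : (0 < `|a|)%N by rewrite absz_gt0.
have [q /andP[q1 qle] nq] := small_nondivisor ha0.
exists (q ^ D)%N; last exact: adet.
rewrite leq_exp2r ?addn_gt0 //; apply: leq_trans qle _.
rewrite -muln2 mulnAC leq_mul2r /=.
set T := trunc_log 2 N.
suff h : (`|a| < 2 ^ (`|C|.+1 + n.+1 * T.+1))%N.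
  have : (trunc_log 2 `|a| <= `|C| + n.+1 * T.+1)%N.
    by rewrite -ltnS -(ltn_exp2l _ _ (isT : 1 < 2)%N) (leq_ltn_trans (trunc_logP _ ha0)).
  by nia.
have [w [hw ew sw]] := word_length_word x gS.
have := hC w hw; rewrite ew => /aB; rewrite -sw in xN.
have EC : C = `|C|%N by rewrite gez0_abs // (le_trans ler01).
rewrite [X in _ <= X * _]EC -abszE -natrX natz -PoszM lez_nat => h.
apply: leq_ltn_trans h _; rewrite expnD.
have hN : ((size w).+1 <= 2 ^ T.+1)%N by apply: leq_ltn_trans xN (trunc_log_ltn _ _).
apply: (@leq_ltn_trans (`|C| * 2 ^ (n.+1 * T.+1))).
  by rewrite leq_mul2l [(n.+1 * _)%N]mulnC expnM leq_exp2r ?hN ?orbT.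
by rewrite ltn_mul2r expn_gt0 /= (leq_trans (ltn_expl _ (isT : 1 < 2)%N)) // leq_exp2l.
Qed.
End Upper.

(** * Lower bounds for the order of detecting quotients *)

Lemma multiplicative1 (G : groupType) (Q : finGroupType) (phi : {multiplicative G -> Q}) :
  phi 1%g = 1%g.
Proof. by apply: (mulgI (phi 1%g)); rewrite -gmulfM !mulg1. Qed.

Lemma kernel_normal (G : groupType) (Q : finGroupType) (phi : {multiplicative G -> Q}) :
  normal_subgroup [set x | phi x = 1%g].
Proof.
have phi1 := multiplicative1 phi.
have phiV x : phi x^-1%g = (phi x)^-1%g.
  by apply: (mulgI (phi x)); rewrite -gmulfM !mulgV.
split; first split=> //=.
- by move=> x y hx hy; rewrite gmulfM hx hy mulg1.
- by move=> x hx; rewrite phiV hx invg1.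
- by move=> x y hx /=; rewrite conjgE !gmulfM hx mul1g -gmulfM mulVg.
Qed.

Lemma multiplicative_exp (G : groupType) (Q : finGroupType) (phi : {multiplicative G -> Q}) x k :
  phi (x ^+ k)%g = (phi x ^+ k)%g.
Proof.
have phi1 := multiplicative1 phi.
by elim: k => [|k IH]; rewrite ?expg0 // !expgS gmulfM IH.
Qed.

Section Lower.
Variables (l m : nat) (g : bool).
Local Notation n := (l.+2 + m)%N.
Local Notation G := (shift_group l m g 1 int).
(* The factorial absorbs the factor j! that iterated differences produce from a
   polynomial of degree j <= l + 1. *)
Local Notation z := (const_elt l m g (ord0 : 'I_1) (l.+1)`!%:R).

Lemma const_elt_fact_exp k : (z ^+ k)%g = const_elt l m g (ord0 : 'I_1) (k * l.+1`!)%:R.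
Proof. by rewrite /const_elt module_eltX -scaler_nat scalerA -natrM. Qed.

Lemma col_mul_const_row (A : 'M[int]_(1, n)) j k :
  col j A *+ k *m const_row l m int = (A ord0 j *+ k) *: delta_mx ord0 (const_ix l m).
Proof.
rewrite delta_const_ix scalemxAl; congr (_ *m _); apply/matrixP => i j'.
by rewrite !ord1 mulmxnE !mxE mulr1.
Qed.

(** If two elements of the box of side r have the same image, their quotient is in
    the kernel. Its coordinates are compared from the outside in: s by the function
    X, then t by the extra functions, then the extra components of the module part
    by translations along them, and last the polynomial part by iterated
    differences. At each stage a non-zero coordinate would give a constant in the
    kernel that is too small for the order of z. *)
Lemma finite_quotient_box (Q : finGroupType) (phi : {multiplicative G -> Q}) :
  (#[phi z]%g ^ (1 + m + n) <= #|Q|)%N.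
Proof.
set r := #[phi z]%g.
have nN := kernel_normal phi; set N := [set x | phi x = 1%g] in nN.
have sN : is_subgroup N by case: nN.
(* A kernel element of this form has d divisible by r. *)
have core (d : int) : (`|d| < r)%N -> N (const_elt l m g ord0 (l.+1`!%:R * d)) -> d = 0.
  move=> dr Nd; apply/eqP; rewrite -absz_eq0; apply/eqP.
  have: (r %| `|d|)%N.
    rewrite order_dvdn -multiplicative_exp const_elt_fact_exp; apply/eqP.
    case: d dr Nd => k dr Nd; first by rewrite mulnC natrM (natz k).
    have := const_elt_mul (-1) sN Nd; rewrite NegzE mulN1r mulrN opprK.
    by rewrite mulnC natrM (natz k.+1).
  by have [->//|d0 /(dvdn_leq d0)] := posnP `|d|%N; rewrite leqNgt dr.
have core' (d : int) : (`|d| < r)%N -> N (const_elt l m g ord0 d) -> d = 0.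
  by move=> dr Nd; apply: core => //; apply: const_elt_mul.
pose emb T1 T2 (A : 'M['I_r]_(T1, T2)) := map_mx (fun i : 'I_r => (i : nat)%:Z) A.
have embI T1 T2 : injective (@emb T1 T2).
  move=> A B /matrixP e; apply/matrixP => i j; apply/val_inj.
  by have := e i j; rewrite !mxE => -[].
have lt_r (i i' : 'I_r) : (`| (i' : nat)%:Z - (i : nat)%:Z | < r)%N.
  by move: (ltn_ord i) (ltn_ord i'); lia.
pose box (u : 'I_r * 'M['I_r]_(m, 1) * 'M['I_r]_(1, n)) : G :=
  elt g (u.1.1 : nat)%:Z (emb _ _ u.1.2) (emb _ _ u.2).
suff inj : injective (fun u => phi (box u)).
  have := leq_card _ inj; rewrite !card_prod !card_mx card_ord muln1 mul1n.
  by rewrite -{1}[r]expn1 -!expnD.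
move=> u u' eu; have Nh : N ((box u)^-1 * box u')%g.
  by rewrite /N /= gmulfM -eu -gmulfM mulVg; case: sN.
case: u u' eu Nh => [[s t] P] [[s' t'] P'] _ Nh.
have es : s = s'.
  have := normal_comml (module_elt g (delta_mx ord0 (linear_ix l m))) nN Nh.
  rewrite comm_linear shift_mulE shift_invE /= => /core' h; apply/val_inj.
  have := h _; rewrite addrC => /(_ (lt_r s s'))/eqP; rewrite subr_eq0 => /eqP[]//.
rewrite -{s'}es in Nh *.
have et : t = t'.
  apply/matrixP => k j; rewrite [j]ord1.
  have := normal_comml (module_elt g (delta_mx ord0 (rshift l.+2 k))) nN Nh.
  rewrite comm_extra; last by rewrite shift_mulE shift_invE /= addNr.
  rewrite shift_mulE shift_invE /= !mxE addrC => /core' h; apply/val_inj.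
  by have := h (lt_r _ _) => /eqP; rewrite subr_eq0 => /eqP[].
rewrite -{t'}et in Nh *.
congr (_, _, _); apply/embI/eqP; rewrite eq_sym -subr_eq0; apply/negPn/negP => A0.
rewrite shift_divE // in Nh; rewrite -[(_, _)]/(module_elt g (emb _ _ P' - emb _ _ P)) in Nh.
set A := emb _ _ P' - emb _ _ P in A0 Nh.
have lt_A j : (`|A ord0 j| < r)%N by rewrite !mxE; apply: lt_r.
have AY k : A ord0 (rshift l.+2 k) = 0.
  apply: core' => //; have := normal_commr (elt g 0 (delta_mx k ord0) 0) nN Nh.
  by rewrite comm_module_extra -[col _ A]mulr1n col_mul_const_row.
have [j Aj] : exists j, A ord0 j != 0.
  apply: contrapT => /forallNP h; case/eqP: A0; apply/rowP => j; rewrite [RHS]mxE.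
  by apply/eqP/negPn/negP; exact: h.
pose B := fun j : 'I_n => A ord0 j != 0.
case: (@arg_maxnP _ j B (@nat_of_ord n) Aj) => k Bk mx.
have kl : (k < l.+2)%N.
  rewrite ltnNge; apply/negP => lk; case/eqP: (Bk).
  have kk : (k - l.+2 < m)%N by rewrite ltn_subLR.
  by rewrite -(AY (Ordinal kk)); congr (A _ _); apply/val_inj; rewrite /= subnKC.
case/eqP: Bk; apply: core => //.
have Ak0 (i : 'I_1) (k' : 'I_n) : (k < k')%N -> A i k' = 0.
  move=> lt; rewrite ord1; apply/eqP/negPn/negP => Ak'.
  by have /(_ Ak') := mx k'; rewrite /= leqNgt lt.
have := normal_lead nN (leq_trans kl (leq_addr g _)) Ak0 Nh.
have kf : (k`! %| l.+1`!)%N by rewrite -(bin_fact (kl : k <= l.+1)%N) mulnCA dvdn_mulr.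
rewrite col_mul_const_row.
move=> /(const_elt_mul (l.+1`! %/ k`!)%:R sN).
by rewrite -[A ord0 k *+ _]mulr_natl mulrA -natrM divnK.
Qed.

Lemma const_elt_fact_expn_neq1 k : (0 < k)%N -> (z ^+ k)%g <> 1%g.
Proof.
move=> k0; rewrite const_elt_fact_exp => /module_elt_inj/matrixP/(_ ord0 (const_ix l m))/eqP.
by rewrite !mxE !eqxx mulr1 pnatr_eq0 muln_eq0 -!leqn0 leqNgt k0 leqNgt fact_gt0.
Qed.

End Lower.

(** If z ^ N survives, the order of the image of z does not divide N, hence exceeds
    x. *)
Lemma detection_lower (G : groupType) (S : seq G) (z : G) D : (0 < D)%N -> generates S ->
  (forall k, (0 < k)%N -> (z ^+ k)%g <> 1%g) ->
  (forall (Q : finGroupType) (phi : {multiplicative G -> Q}), (#[phi z]%g ^ D <= #|Q|)%N) ->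
  exists K, forall x : nat, exists y, [/\ y <> 1%g, (word_length S y <= K * 16 ^ x)%N &
    forall q, detects y q -> (x.+1 ^ D <= q)%N].
Proof.
move=> D0 gS zX box; exists (word_length S z) => x.
have [N /andP[N0 Nle] Ndiv] := small_common_multiple x.
exists (z ^+ N)%g; split; first exact: zX.
- apply: leq_trans (word_length_exp _ _ gS) _.
  by rewrite mulnC leq_mul2l Nle orbT.
move=> q [Q [phi [_ h <-]]]; apply: leq_trans (box Q phi).
rewrite leq_exp2r // ltnNge; apply/negP => rx; apply: h.
rewrite multiplicative_exp; apply/eqP; rewrite -order_dvdn; apply: Ndiv.
by rewrite order_gt0.
Qed.

(** * Logarithmic growth *)

Section Growth.
Variable R : realType.

Lemma preceq_trans (f h k : nat -> R) : preceq f h -> preceq h k -> preceq f k.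
Proof.
move=> [C C0 hC] [C' C'0 hC']; exists (C * C')%N => [|n n0]; first by rewrite muln_gt0 C0.
apply: le_trans (hC n n0) _; rewrite natrM -mulrA ler_wpM2l //.
have -> : (C * C' * n = C' * (C * n))%N by rewrite mulnCA mulnA.
by apply: hC'; rewrite muln_gt0 n0 C0.
Qed.

Lemma ln_nat_ge0 n : 0 <= ln n%:R :> R.
Proof.
case: n => [|n]; first by rewrite ln0.
by rewrite ln_ge0 // ler1n.
Qed.

Lemma ler_ln_nat m n : (0 < m <= n)%N -> ln m%:R <= ln n%:R :> R.
Proof.
move=> /andP[m0 mn]; rewrite ler_ln ?ler_nat // posrE ltr0n //.
exact: leq_trans mn.
Qed.

Lemma log_pow_preceq m D : (m <= D)%N -> preceq (log_pow R m) (log_pow R D).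
Proof.
move=> mD; (* C >= e makes the logarithm at least 1, where powers increase with the exponent. *)
pose C := (Num.bound (expR 1 : R)).
have hC : expR 1 < C%:R :> R by apply: archi_boundP; apply: expR_ge0.
have C0 : (0 < C)%N by rewrite -(ltr_nat R) (lt_trans _ hC) // expR_gt0.
exists C => // n n0; rewrite /log_pow.
have h1 : 1 <= ln (C * n)%:R :> R.
  have : ln (expR 1) <= ln (C * n)%:R :> R; last by rewrite expRK.
  rewrite ler_ln ?posrE ?expR_gt0 ?ltr0n ?muln_gt0 ?C0 //.
  by rewrite (le_trans (ltW hC)) // ler_nat leq_pmulr.
apply: (@le_trans _ _ (ln (C * n)%:R ^+ m)).
  by rewrite lerXn2r ?nnegrE ?ln_nat_ge0 // ler_ln_nat // n0 leq_pmull.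
apply: (@le_trans _ _ (ln (C * n)%:R ^+ D)); first by rewrite ler_weXn2l.
by rewrite ler_peMl ?exprn_ge0 ?ln_nat_ge0 // ler1n.
Qed.

Section FromDetection.
Variables (G : groupType) (S : seq G) (D c0 : nat).
Hypothesis upper : forall N x, (0 < N)%N -> x <> 1%g -> (word_length S x <= N)%N ->
  exists2 q, (q <= (c0 * (trunc_log 2 N).+1) ^ D)%N & detects x q.

Lemma rf_growth_preceq_log : preceq (rf_growthR R S) (log_pow R D).
Proof.
have l2 : 0 < ln 2 :> R by rewrite ln_gt0 // ltr1n.
pose A : R := (c0%:R / ln 2) ^+ D.
have A0 : 0 <= A by rewrite exprn_ge0 // divr_ge0 // ltW.
exists (Num.bound A).+2 => // N N0; rewrite /rf_growthR /log_pow.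
have := rf_growth_le (fun x x1 xN => upper N0 x1 xN).
rewrite -(ler_nat R) => /le_trans; apply; rewrite natrX.
apply: (@le_trans _ _ (A * ln ((Num.bound A).+2 * N)%:R ^+ D)); last first.
  rewrite ler_wpM2r ?exprn_ge0 ?ln_nat_ge0 // ltW // (lt_le_trans (archi_boundP A0)) //.
  by rewrite ler_nat; apply/leqW/leqnSn.
rewrite /A -exprMn lerXn2r ?nnegrE ?mulr_ge0 ?invr_ge0 ?ln_nat_ge0 ?(ltW l2) //.
rewrite natrM -mulrA ler_wpM2l // [leRHS]mulrC ler_pdivlMr // [leLHS]mulr_natl -lnXn //.
apply: (@le_trans _ _ (ln (2 * N)%:R)).
  rewrite -natrX ler_ln_nat // expn_gt0 /= expnS leq_mul2l /=.
  by rewrite trunc_logP.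
by rewrite ler_ln_nat // muln_gt0 N0 /= leq_mul2r orbT.
Qed.

Lemma log_preceq_rf_growth K :
  (forall x : nat, exists y, [/\ y <> 1%g, (word_length S y <= K * 16 ^ x)%N &
     forall q, detects y q -> (x.+1 ^ D <= q)%N]) ->
  preceq (log_pow R D) (rf_growthR R S).
Proof.
move=> lower; have l16 : 0 <= ln 16 :> R by rewrite ln_ge0 // ler1n.
pose C := ((Num.bound (ln 16 ^+ D : R)) + K).+1.
exists C => // N N0; rewrite /rf_growthR /log_pow.
pose x := trunc_log 16 N; have [y [y1 yle yq]] := lower x.
have CN0 : (0 < C * N)%N by rewrite muln_gt0 N0.
have hy : (word_length S y <= C * N)%N.
  apply: leq_trans yle _; rewrite leq_mul //; last by rewrite trunc_logP.
  by rewrite /C ltnW // ltnS leq_addl.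
have := rf_growth_ge (fun x x1 xN => upper CN0 x1 xN) y1 hy yq.
rewrite -(ler_nat R) natrX => h.
apply: (@le_trans _ _ (ln 16 ^+ D * x.+1%:R ^+ D)).
  rewrite -exprMn lerXn2r ?nnegrE ?mulr_ge0 ?ln_nat_ge0 //.
  rewrite mulr_natr -lnXn // -natrX ler_ln_nat // N0 /=.
  by rewrite ltnW // trunc_log_ltn.
apply: ler_pM => //; rewrite ?exprn_ge0 //.
rewrite ltW // (lt_le_trans (archi_boundP _)) ?exprn_ge0 // ler_nat.
by rewrite /C -addSn leqW // leq_addr.
Qed.

End FromDetection.

Lemma shift_rf_preceq l m g b :
  rf_preceq (shift_group l m g b int) (log_pow R (1 + m + (0 < b) * (l.+2 + m))).
Proof.
by move=> S /detection_upper[c0 h]; apply: (rf_growth_preceq_log (c0 := c0)) => N x; apply: h.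
Qed.

Lemma shift_rf_equiv l m g :
  rf_equiv (shift_group l m g 1 int) (log_pow R (1 + m + (l.+2 + m))).
Proof.
move=> S gS; split.
  by have := @shift_rf_preceq l m g 1 S gS; rewrite mul1n.
have [c0 up] := detection_upper gS; rewrite mul1n in up.
have [||K low] := @detection_lower _ S (const_elt l m g (ord0 : 'I_1) (l.+1)`!%:R)
    (1 + m + (l.+2 + m)) isT gS.
- exact: const_elt_fact_expn_neq1.
- exact: finite_quotient_box.
by apply: (log_preceq_rf_growth (c0 := c0)) low => N x; apply: up.
Qed.

Lemma integers_rf_equiv : rf_equiv (shift_group 0 0 false 0 int) (log_pow R 1).
Proof.
move=> S gS; split; first exact: (@shift_rf_preceq 0 0 false 0 S gS).
have [c0 up] := detection_upper gS.
have [||K low] := @detection_lower _ S (elt false 1 0 0) 1 isT gS.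
- move=> [//|k] _ /(congr1 (fun x : shift_group 0 0 false 0 int => x.1.1)).
  rewrite shift_expE /= raddfMn /= => /eqP; by rewrite mulrn_eq0.
- move=> Q phi; rewrite expn1; exact: max_card.
by apply: (log_preceq_rf_growth (c0 := c0)) low => N x; apply: up.
Qed.

Lemma shift_group_irreducible_tf_fg_nilpotent l m g b : (0 < b)%N ->
  irreducible_tf_fg_nilpotent (shift_group l m g b int).
Proof.
move=> b0; split; [exact: shift_irreducible|exact: shift_torsion_free|
  exact: shift_finitely_generated|exact: shift_nilpotent].
Qed.

Lemma integers_irreducible_tf_fg_nilpotent :
  irreducible_tf_fg_nilpotent (shift_group 0 0 false 0 int).
Proof.
by split; [exact: integers_irreducible|exact: shift_torsion_free|
  exact: shift_finitely_generated|exact: shift_nilpotent].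
Qed.

(** Take l = c - 2 without gluing for even c and l = c - 3 with gluing for odd c; then
    l is even and M - l./2 extra translations give the exponent. *)
Lemma odd_exponent_of_step c M : (2 <= c <= M)%N -> exists G : groupType,
  [/\ irreducible_tf_fg_nilpotent G, step_length G = c & rf_equiv G (log_pow R (M.*2 + 3))].
Proof.
move=> /andP[c2 cM].
have [l [g [ec gl el]]] : exists l (g : bool), [/\ c = (l.+2 + g)%N, (g -> 0 < M - l./2)%N &
    (M.*2 + 3 = 1 + (M - l./2) + (l.+2 + (M - l./2)))%N].
  have oc := odd_double_half c.
  exists (c./2.-1.*2)%N, (odd c); rewrite doubleK.
  split; last 1 [idtac]; lia.
exists (shift_group l (M - l./2) g 1 int); split.
- exact: shift_group_irreducible_tf_fg_nilpotent.
- by rewrite shift_step_length.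
- by rewrite el; apply: shift_rf_equiv.
Qed.

End Growth.

Theorem theorem1p5 (R : realType) :
  (forall c : nat, (0 < c)%N ->
     exists2 m : nat, (0 < m)%N &
       forall ell : nat, (0 < ell)%N -> (c = 1%N -> ell = 1%N) ->
         exists G : groupType,
           [/\ irreducible_tf_fg_nilpotent G, step_length G = c,
               (ell <= hirsch_length G)%N & rf_preceq G (log_pow R m)]) /\
  (forall m : nat, (0 < m)%N -> m <> 2%N ->
     exists2 G : groupType,
       irreducible_tf_fg_nilpotent G & rf_equiv G (log_pow R m)) /\
  (forall c1 c2 : nat, (2 <= c1)%N -> (c1 < c2)%N ->
     forall ell : nat, (0 < ell)%N ->
       exists G D : groupType,
         [/\ irreducible_tf_fg_nilpotent G, irreducible_tf_fg_nilpotent D,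
             step_length G = c1, step_length D = c2 & rf_equiv_rf R G D]) /\
  (forall c m : nat, (1 < c)%N -> (1 <= m)%N ->
     exists G : groupType,
       [/\ irreducible_tf_fg_nilpotent G, step_length G = c
         & preceq_rf (log_pow R m) G]).
Proof.
split; [|split; [|split]].
- case=> [//|[_|c _]].
    exists 1%N => // ell _ /(_ erefl) ->; exists (shift_group 0 0 false 0 int); split.
    + exact: integers_irreducible_tf_fg_nilpotent.
    + exact: integers_step_length.
    + exact: integers_hirsch_length.
    + by move=> S gS; case: (integers_rf_equiv R gS).
  exists (1 + c.+2)%N => // ell ell0 _.
  exists (shift_group c 0 false ell int); split.
  + exact: shift_group_irreducible_tf_fg_nilpotent.
  + by rewrite shift_step_length // addn0.
  + by apply: leq_trans (shift_hirsch_length c 0 false ell); rewrite leq_pmulr.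
  + by have := @shift_rf_preceq R c 0 false ell; rewrite ell0 mul1n !addn0.
- case=> [|[|[|m]]] // _ _.
    by exists (shift_group 0 0 false 0 int);
      [exact: integers_irreducible_tf_fg_nilpotent|exact: integers_rf_equiv].
  exists (shift_group m 0 false 1 int); first exact: shift_group_irreducible_tf_fg_nilpotent.
  by have := @shift_rf_equiv R m 0 false; rewrite !addn0.
- move=> c1 c2 h1 h12 ell _.
  have [G [gG sG eG]] := @odd_exponent_of_step R c1 c2 (introT andP (conj h1 (ltnW h12))).
  have c2_2 := leq_trans h1 (ltnW h12).
  have [H [gH sH eH]] := @odd_exponent_of_step R c2 c2 (introT andP (conj c2_2 (leqnn _))).
  exists G, H; split=> // S T gS gT.
  have [a1 a2] := eG S gS; have [b1 b2] := eH T gT.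
  by split; [exact: preceq_trans a1 b2|exact: preceq_trans b1 a2].
- move=> c m c1 m1.
  have [G [gG sG eG]] := @odd_exponent_of_step R c (maxn c m)
    (introT andP (conj c1 (leq_maxl c m))).
  exists G; split=> // S gS; have [_ a2] := eG S gS.
  apply: preceq_trans a2; apply: log_pow_preceq.
  by have := leq_maxr c m; lia.
Qed.
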